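(* Let $AG_n$ denote the $n$-dimensional alternating group graph. Then $\kappa_3(AG_n)=4n-10$ and $\kappa_4(AG_n)=6n-16$ for all $n\geqslant 4$, and $\kappa_5(AG_n)=8n-24$ for all $n\geqslant 5$.
   Context: For an integer $\ell\geqslant 2$, the $\ell$-component connectivity $\kappa_\ell(G)$ of a graph $G$ is the minimum number of vertices whose removal from $G$ results in a disconnected graph with at least $\ell$ components or a graph with fewer than $\ell$ vertices. For $n\geqslant 3$, permutations $p=p_1p_2\cdots p_n$ of $\{1,\dots,n\}$ are written as words; $\mathcal A_n$ is the set of even permutations. For $3\leqslant i\leqslant n$, $p\,\mathrm{g}_i^+$ is the permutation obtained from $p$ by placing $p_i,p_1,p_2$ at positions $1,2,i$ respectively (all other positions unchanged), and $p\,\mathrm{g}_i^-$ is obtained by placing $p_2,p_i,p_1$ at positions $1,2,i$ respectively (e.g. for $p=13425$: $p\mathrm{g}_4^+=21435$, $p\mathrm{g}_4^-=32415$). The alternating group graph $AG_n$ has vertex set $\mathcal A_n$, with $p,q$ adjacent iff $q\in\{p\mathrm{g}_i^+,p\mathrm{g}_i^-\}$ for some $i\in\{3,\dots,n\}$. *)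

(* Defs.v *)
From mathcomp Require Import all_boot all_order all_fingroup.
Set Implicit Arguments. Unset Strict Implicit. Unset Printing Implicit Defensive.

Section Components.
Variable T : finType.

Definition induced_rel (e : rel T) (W : {set T}) : rel T :=
  fun x y => [&& x \in W, y \in W & e x y].

Definition ncomp (e : rel T) (W : {set T}) : nat :=
  #|[set [set y in W | connect (induced_rel e W) x y] | x in W]|.

Definition lcomp_cut (l : nat) (V : {set T}) (e : rel T) (S : {set T}) : bool :=
  (S \subset V) && ((l <= ncomp e (V :\: S)) || (#|V :\: S| < l)).

(* l-component connectivity kappa_l(G): minimum size of such a set
   (V itself is always such a set, so #|V| is a valid default) *)
Definition kappa_l (l : nat) (V : {set T}) (e : rel T) : nat :=
  \big[minn/#|V|]_(S : {set T} | lcomp_cut l V e S) #|S|.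
End Components.

(** * Alternating group graph AG_n.
    Permutations p of {0,...,n-1} (positions 0-based: paper's positions 1,2,i
    are our 0,1,k with k = i-1, 2 <= k <= n-1). *)

(* position maps: (p g_i^+)_j = p_(sigp j), (p g_i^-)_j = p_(sigm j) *)
Definition sigp_nat (k j : nat) : nat :=
  if j == 0 then k else if j == 1 then 0 else if j == k then 1 else j.
Definition sigm_nat (k j : nat) : nat :=
  if j == 0 then 1 else if j == 1 then k else if j == k then 0 else j.

Definition AG_vertices (n : nat) : {set {perm 'I_n}} :=
  [set p : {perm 'I_n} | ~~ odd_perm p].

Definition AG_adj (n : nat) : rel {perm 'I_n} :=
  fun p q => [exists k : 'I_n, (2 <= k) &&
    ([forall j : 'I_n, q j == p (insubd j (sigp_nat k j))] ||
     [forall j : 'I_n, q j == p (insubd j (sigm_nat k j))])].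

(* Main.v *)
(* The words of AG_n with a fixed last symbol form n copies of AG_{n-1}; a vertex
   has one neighbour in each of two other copies, and with them forms a triangle.
   Let S be a cut smaller than the claimed bound kap t n := 2tn - (0,4,10,16,24)_t
   that leaves at least t+1 components.  Call a copy bad when S deletes at least
   2(n-1)-4 of its vertices.  By induction good copies stay connected, and they are
   joined to each other into one giant component; at most three copies are bad, and
   the t other components live there.  A bad copy with x of them contains at least
   kap x (n-1) deleted vertices, and every component off the giant one also forces
   deleted vertices outside the bad copies, distinct components forcing distinct
   ones since the triangles are disjoint.  Adding up contradicts the size of S,
   except for the distributions (2,1), (1,1,1) and (2,1,1) of the components over
   the bad copies, where one more deleted vertex has to be found.  The bound is
   attained by isolating words obtained from each other by the Klein four-group
   acting on positions 1, 2, 3, 4. *)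
Require Import Defs.
From mathcomp Require Import all_boot all_order all_fingroup.
From mathcomp Require Import zify.
Set Implicit Arguments. Unset Strict Implicit. Unset Printing Implicit Defensive.

(** * Counting components by systems of representatives *)

Lemma subset_of_card (T : finType) (A : {set T}) (t : nat) :
  t <= #|A| -> exists2 B : {set T}, B \subset A & #|B| = t.
Proof.
move=> tA; exists [set x in take t (enum A)].
  by apply/subsetP=> x; rewrite inE => /mem_take; rewrite mem_enum.
rewrite cardsE (card_uniqP _) ?take_uniq ?enum_uniq //.
by rewrite size_takel // -cardE.
Qed.

Section Separated.
Variables (T : finType) (e : rel T).
Implicit Types (W R : {set T}) (x y : T).

(** At most one vertex is taken from each component. Unlike the number [ncomp], such a set can be
    cut down to one copy or enlarged by a single vertex. *)
Definition separated W R :=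
  {subset R <= W} /\
  {in R &, forall x y, connect (induced_rel e W) x y -> x = y}.

Lemma separatedS W R R' : R' \subset R -> separated W R -> separated W R'.
Proof.
move=> /subsetP sR [RW sep]; split=> [x /sR /RW //|x y /sR xR /sR yR].
exact: sep.
Qed.

Lemma card_separated_ncomp W R : separated W R -> #|R| <= ncomp e W.
Proof.
case=> RW sep; rewrite /ncomp.
set f := fun x => [set y in W | connect (induced_rel e W) x y].
have finj : {in R &, injective f}.
  move=> x y xR yR fxy; apply: sep => //.
  have: y \in f y by rewrite inE RW //= connect0.
  by rewrite -fxy inE => /andP[].
rewrite -(card_in_imset finj); apply: subset_leq_card.
by apply: imsetS; apply/subsetP.
Qed.

Hypothesis e_sym : symmetric e.

Lemma induced_connect_sym W : connect_sym (induced_rel e W).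
Proof.
by apply: sym_connect_sym => x y; rewrite /induced_rel e_sym andbCA.
Qed.

Lemma connect_induced_mem W x y :
  connect (induced_rel e W) x y -> x \in W -> y \in W.
Proof.
move=> cxy xW; rewrite -(closed_connect _ cxy) //.
apply: intro_closed => [|a b /and3P[]//]; exact: induced_connect_sym.
Qed.

Lemma connect_induced_step W x y :
  x \in W -> y \in W -> e x y -> connect (induced_rel e W) x y.
Proof. by move=> xW yW exy; apply: connect1; apply/and3P. Qed.

Lemma ncomp_separated W t :
  t <= ncomp e W -> exists2 R : {set T}, separated W R & #|R| = t.
Proof.
pose r := induced_rel e W; have rsym := induced_connect_sym W : connect_sym r.
pose f := fun x => [set y in W | connect r x y].
(* The canonical [root] gives one representative in each component. *)
pose R := [set x in W | root r x == x].
have leR : ncomp e W <= #|R|.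
  apply: leq_trans (leq_imset_card f R); apply: subset_leq_card.
  apply/subsetP=> _ /imsetP[x xW ->]; apply/imsetP; exists (root r x).
    by rewrite inE root_root // eqxx andbT (connect_induced_mem (connect_root r x)).
  apply/setP=> y; rewrite !inE; congr (_ && _).
  exact: (same_connect rsym (connect_root r x)).
move=> /leq_trans/(_ leR) /subset_of_card[R' sR' cR'].
exists R' => //; apply: separatedS sR' _; split=> [x|x y].
  by rewrite inE => /andP[].
rewrite !inE => /andP[_ /eqP rx] /andP[_ /eqP ry] /(rootP rsym).
by rewrite rx ry.
Qed.

End Separated.

Lemma connect_induced_sub (T : finType) (e e' : rel T) (W W' : {set T}) x y :
  subrel e e' -> W \subset W' ->
  connect (induced_rel e W) x y -> connect (induced_rel e' W') x y.
Proof.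
move=> ee' /subsetP WW'; apply: connect_sub => {}x {}y /and3P[xW yW exy].
by apply: connect1; apply/and3P; split; [exact: WW'|exact: WW'|exact: ee'].
Qed.

(** The index [t] counts the components besides the giant one, so this is the intended value of
    $\kappa_{t+1}(AG_j)$. Only [t] up to 4 matters; [kap 1 j] is the degree of $AG_j$. *)
Definition kap (t j : nat) : nat :=
  match t with
  | 0 => 0 | 1 => 2 * j - 4 | 2 => 4 * j - 10 | 3 => 6 * j - 16
  | _ => 8 * j - 24 end.

(** * Generators, and the copies of smaller alternating group graphs *)

Section Gen.
Variable m : nat.
Notation n := m.+4.
Notation T := {perm 'I_n}.
Implicit Types (p q r : T) (i k l x : 'I_n).

Definition i0 : 'I_n := ord0.
Definition i1 : 'I_n := @Ordinal n 1 isT.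

(* [gen k * p] is the paper's [p g_(k+1)^+], and [gen k] has order 3. *)
Definition gen k : T := (tperm i0 i1 * tperm i1 k)%g.

Lemma ord_cases x : [\/ x = i0, x = i1 | 1 < x].
Proof.
case: x => [[|[|x]] lt_x]; [apply: Or31|apply: Or32|exact: Or33];
exact: val_inj.
Qed.

Lemma i0_neq k : 1 < k -> (i0 == k) = false.
Proof. by move=> k1; apply/eqP => /(congr1 val) /=; lia. Qed.
Lemma i1_neq k : 1 < k -> (i1 == k) = false.
Proof. by move=> k1; apply/eqP => /(congr1 val) /=; lia. Qed.

Section GenFixed.
Variable k : 'I_n.
Hypothesis k2 : 1 < k.

Lemma gen_0 : gen k i0 = k.
Proof. by rewrite permM tpermL tpermL. Qed.
Lemma gen_1 : gen k i1 = i0.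
Proof. by rewrite permM tpermR tpermD // eq_sym i0_neq. Qed.
Lemma gen_k : gen k k = i1.
Proof. by rewrite permM [tperm i0 i1 k]tpermD ?i0_neq ?i1_neq ?tpermR. Qed.
Lemma gen_fix x : 1 < x -> x != k -> gen k x = x.
Proof.
by move=> x1 xk; rewrite permM !tpermD ?i0_neq ?i1_neq // eq_sym.
Qed.

Lemma gen_cube x : gen k (gen k (gen k x)) = x.
Proof.
have [->|->|x1] := ord_cases x; first by rewrite gen_0 gen_k gen_1.
  by rewrite gen_1 gen_0 gen_k.
have [->|xk] := eqVneq x k; first by rewrite gen_k gen_1 gen_0.
by rewrite !gen_fix.
Qed.

Lemma odd_gen : odd_perm (gen k) = false.
Proof. by rewrite odd_permM !odd_tperm i1_neq. Qed.

Definition turn p : T := (gen k * p)%g.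

Lemma turnE p x : turn p x = p (gen k x). Proof. exact: permM. Qed.
Lemma turn_0 p : turn p i0 = p k. Proof. by rewrite turnE gen_0. Qed.
Lemma turn_1 p : turn p i1 = p i0. Proof. by rewrite turnE gen_1. Qed.
Lemma turn_k p : turn p k = p i1. Proof. by rewrite turnE gen_k. Qed.
Lemma turn_fix p x : 1 < x -> x != k -> turn p x = p x.
Proof. by move=> x1 xk; rewrite turnE gen_fix. Qed.
Lemma turn3 p : turn (turn (turn p)) = p.
Proof. by apply/permP => x; rewrite !turnE gen_cube. Qed.
Lemma turn_inj : injective turn.
Proof. exact: mulgI. Qed.
Lemma odd_turn p : odd_perm (turn p) = odd_perm p.
Proof. by rewrite odd_permM odd_gen. Qed.

End GenFixed.

(** The bound [k < j] gives adjacency of $AG_j$ on words of the fixed length [n], so that the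
    induction on dimension stays within one type. *)
Definition adj (j : nat) : rel T := fun p q =>
  [exists k : 'I_n, [&& 1 < k, k < j & (q == turn k p) || (p == turn k q)]].

Lemma adjP j p q : reflect
  (exists k : 'I_n, [/\ 1 < k, k < j & q = turn k p \/ p = turn k q]) (adj j p q).
Proof.
apply: (iffP existsP) => -[k].
  by case/and3P=> k1 kj /orP pq; exists k; split=> //; case: pq => /eqP; auto.
case=> k1 kj pq; exists k; rewrite k1 kj /=; apply/orP.
by case: pq => ->; rewrite eqxx; auto.
Qed.

Lemma adj_sym j : symmetric (adj j).
Proof. by move=> p q; apply/eq_existsb => k; rewrite orbC. Qed.

Lemma adj_le j j' : j <= j' -> subrel (adj j) (adj j').
Proof.
move=> jj' p q /adjP[k [k1 kj pq]]; apply/adjP; exists k; split=> //.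
exact: leq_trans jj'.
Qed.

(** The default of [insubd] is never taken, since the number [sigp_nat k x] is the value of an
    ordinal. *)
Lemma sigp_gen k x : 1 < k -> insubd x (sigp_nat k x) = gen k x.
Proof.
move=> k1; suff E : sigp_nat k x = gen k x.
  by apply/val_inj; rewrite val_insubd E ltn_ord.
rewrite /sigp_nat; have [->|->|x1] := ord_cases x; rewrite ?gen_0 ?gen_1 //.
have -> : (x == 0 :> nat) = false by lia.
have -> : (x == 1 :> nat) = false by lia.
by case: (eqVneq x k) => [->|xk]; rewrite ?eqxx ?gen_k ?(inj_eq val_inj) // (negPf xk) gen_fix.
Qed.

Lemma sigm_gen k x : 1 < k -> insubd x (sigm_nat k x) = gen k (gen k x).
Proof.
move=> k1; suff E : sigm_nat k x = gen k (gen k x).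
  by apply/val_inj; rewrite val_insubd E ltn_ord.
rewrite /sigm_nat; have [->|->|x1] := ord_cases x.
- by rewrite gen_0 ?gen_k.
- by rewrite gen_1 ?gen_0.
have -> : (x == 0 :> nat) = false by lia.
have -> : (x == 1 :> nat) = false by lia.
case: (eqVneq x k) => [->|xk]; first by rewrite eqxx gen_k // gen_1.
by rewrite (inj_eq val_inj) (negPf xk) !gen_fix.
Qed.

(** As [gen k] has order 3, $g_k^-$ is [turn k] applied twice, that is, its inverse; so this
    neighbour [q] of [p] is the one with [p = turn k q]. *)
Lemma AG_adjE : @AG_adj n =2 adj n.
Proof.
move=> p q; apply: eq_existsb => k; case k1: (1 < k) => //=.
rewrite ltn_ord /=; congr (_ || _).
  apply/forallP/eqP => [H|-> x]; last by rewrite sigp_gen // turnE.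
  by apply/permP => x; rewrite turnE (eqP (H x)) sigp_gen.
apply/forallP/eqP => [H|-> x]; last by rewrite sigm_gen // turnE gen_cube.
by apply/permP => x; rewrite turnE (eqP (H _)) sigm_gen // gen_cube.
Qed.

(* The vertices of the copy of [AG_j] through [p0]: positions below [j] are free. *)
Definition cell (j : nat) (p0 : T) : {set T} :=
  [set p : T | ~~ odd_perm p & [forall x : 'I_n, (j <= x) ==> (p x == p0 x)]].

Lemma cellP j p0 p : reflect
  (~~ odd_perm p /\ forall x, j <= x -> p x = p0 x) (p \in cell j p0).
Proof.
rewrite inE; apply: (iffP andP) => -[-> H]; split=> //.
  by move=> x jx; move/forallP/(_ x): H; rewrite jx => /eqP.
by apply/forallP => x; apply/implyP=> /H ->.
Qed.

Lemma cell_full p0 : cell n p0 = AG_vertices n.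
Proof.
apply/setP=> p; rewrite !inE; case: (~~ odd_perm p) => //=.
by apply/forallP => x; rewrite leqNgt ltn_ord.
Qed.

Lemma cell_even j p0 p : p \in cell j p0 -> odd_perm p = false.
Proof. by case/cellP=> /negPf. Qed.

Lemma cell_congr j p0 q : q \in cell j p0 -> cell j q = cell j p0.
Proof.
case/cellP=> _ qp; apply/setP=> p; rewrite !inE; congr (_ && _).
apply: eq_forallb => x; case jx: (j <= x) => //=; by rewrite qp.
Qed.

Lemma cell_turn j p0 k p : 1 < k < j -> (turn k p \in cell j p0) = (p \in cell j p0).
Proof.
case/andP=> k1 kj; rewrite !inE odd_turn //; congr (_ && _).
apply: eq_forallb => x; case jx: (j <= x) => //=; rewrite turn_fix //; first by lia.
by apply: contraTneq jx => ->; rewrite -ltnNge.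
Qed.

Lemma cell_adj j p0 p q : adj j p q -> (q \in cell j p0) = (p \in cell j p0).
Proof. by case/adjP=> k [k1 kj [->|->]]; rewrite cell_turn // k1. Qed.

(** The only freedom left is to exchange the symbols at positions 0 and 1, which changes the
    parity. *)
Lemma even_perm_eq p q : odd_perm p = odd_perm q ->
  (forall x, 1 < x -> p x = q x) -> p = q.
Proof.
move=> opq H.
have [E|N] := eqVneq (p i0) (q i0).
  apply/permP=> x; have [->|->|/H//] := ord_cases x; first exact: E.
  have : q ((q^-1)%g (p i1)) = p i1 by rewrite permKV.
  have [->|->|y1] := ord_cases ((q^-1)%g (p i1)) => //.
    by rewrite -E => /perm_inj.
  by rewrite -H // => /perm_inj yi; rewrite yi in y1.
suff pq : p = (tperm i0 i1 * q)%g by move: opq; rewrite pq odd_permM odd_tperm; case: odd_perm.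
have p0 : p i0 = q i1.
  have : q ((q^-1)%g (p i0)) = p i0 by rewrite permKV.
  have [->|->|y1] := ord_cases ((q^-1)%g (p i0)) => //.
    by move=> E; rewrite E eqxx in N.
  by rewrite -H // => /perm_inj yi; rewrite yi in y1.
have p1 : p i1 = q i0.
  have : q ((q^-1)%g (p i1)) = p i1 by rewrite permKV.
  have [->|->|y1] := ord_cases ((q^-1)%g (p i1)) => //.
    by rewrite -p0 => /perm_inj.
  by rewrite -H // => /perm_inj yi; rewrite yi in y1.
apply/permP=> x; rewrite permM.
have [->|->|x1] := ord_cases x; rewrite ?tpermL ?tpermR //.
by rewrite tpermD ?i0_neq ?i1_neq ?H.
Qed.

(** A 3-cycle through [x], [y] and a third free position [z] carries the symbol [b] from [x] to [y].
    A transposition would not do, as it leaves the even words. *)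
Lemma card_cell_pos_le j p0 (b x y : 'I_n) : 2 < j -> x < j -> y < j ->
  #|[set p in cell j p0 | p x == b]| <= #|[set p in cell j p0 | p y == b]|.
Proof.
move=> j2 xj yj; have [->//|xy] := eqVneq x y.
have [z zj [zx zy]] : exists2 z : 'I_n, z < j & z != x /\ z != y.
  have : [\/ (0 != x) && (0 != y), (1 != x) && (1 != y) | (2 != x) && (2 != y)].
    have : (x != y :> nat) by [].
    by case: x {xy xj} => [[|[|x]] ?]; case: y {yj} => [[|[|y]] ?] //= E;
      solve [exact: Or31|exact: Or32|exact: Or33].
  case=> /andP[zx zy].
  - by exists i0; [exact: leq_trans j2 | split].
  - by exists i1; [exact: leq_trans j2 | split].
  - by exists (@Ordinal n 2 isT); [exact: leq_trans j2 | split].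
pose h : T := (tperm y z * tperm z x)%g.
have hy : h y = x by rewrite permM !tpermL.
rewrite -(card_imset _ (mulgI h)); apply: subset_leq_card.
apply/subsetP=> _ /imsetP[p /setIdP[/cellP[op pp] /eqP px] ->].
rewrite inE permM hy px eqxx andbT; apply/cellP; split.
  by rewrite !odd_permM !odd_tperm zx eq_sym zy.
move=> u ju; rewrite permM -pp //; congr (p _).
by rewrite permM !tpermD //; apply: contraTneq ju => <-; rewrite -ltnNge.
Qed.

Lemma card_partition_fun (A : finType) (I : finType) (D : {set A}) (f : A -> I) :
  #|D| = \sum_(i : I) #|[set a in D | f a == i]|.
Proof.
rewrite -sum1_card (partition_big f predT) //=; apply: eq_bigr => i _.
by rewrite -sum1_card; apply: eq_bigl => a; rewrite inE.
Qed.

Definition symbols (j : nat) p0 : {set 'I_n} := [set p0 x | x : 'I_n & x < j].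

Lemma card_symbols j p0 : j <= n -> #|symbols j p0| = j.
Proof.
move=> jn; rewrite card_imset; last exact: perm_inj.
rewrite -sum1_card (eq_bigl (fun x : 'I_n => x < j)) => [|x]; last by rewrite inE.
by rewrite -(big_ord_widen n (fun=> 1) jn) sum1_card card_ord.
Qed.

Lemma mem_symbols j p0 p x : p \in cell j p0 -> (p x \in symbols j p0) = (x < j).
Proof.
case/cellP=> _ pp; apply/imsetP/idP => [[y]|xj].
  rewrite inE => yj pxy; rewrite ltnNge; apply/negP => jx.
  by move: pxy; rewrite pp // => /perm_inj xy; rewrite xy leqNgt yj in jx.
exists ((p0^-1)%g (p x)); last by rewrite permKV.
rewrite inE ltnNge; apply/negP => jy; move: (pp _ jy); rewrite permKV.
by move/perm_inj=> xy; rewrite xy leqNgt xj in jy.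
Qed.

(** The words are sorted by the position of [b]; the [j] classes have equal size by
    [card_cell_pos_le]. *)
Lemma card_cell_pos j p0 (b x : 'I_n) : 2 < j <= n -> x < j -> b \in symbols j p0 ->
  j * #|[set p in cell j p0 | p x == b]| = #|cell j p0|.
Proof.
case/andP=> j2 jn xj bj.
rewrite (card_partition_fun (cell j p0) (fun p => (p^-1)%g b)).
rewrite (bigID (fun y : 'I_n => y < j)) /= [X in _ + X]big1 ?addn0 => [|y yj]; last first.
  apply/eqP; rewrite cards_eq0; apply/set0Pn => -[p /setIdP[pc /eqP pb]].
  by case/negP: yj; rewrite -pb -(mem_symbols _ pc) permKV.
rewrite (eq_bigr (fun=> #|[set p in cell j p0 | p x == b]|)) => [|y yj].
  by rewrite -(big_ord_widen n (fun=> _) jn) sum_nat_const card_ord.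
have -> : [set a in cell j p0 | (a^-1)%g b == y] = [set p in cell j p0 | p y == b].
  apply/setP=> p; rewrite !inE; congr (_ && _).
  by apply/eqP/eqP=> [<-|<-]; rewrite ?permKV ?permK.
by apply/eqP; rewrite eqn_leq !card_cell_pos_le.
Qed.

Lemma cell_split j p0 q (l : 'I_n) : val l = j -> q \in cell j.+1 p0 ->
  cell j q = [set p in cell j.+1 p0 | p l == q l].
Proof.
move=> lj /cellP[oq qp]; apply/setP=> p; apply/cellP/setIdP.
  case=> op pq; rewrite (pq l) ?lj // eqxx; split=> //; apply/cellP; split=> //.
  by move=> x jx; rewrite pq ?qp // ltnW.
case=> /cellP[op pp] /eqP pl; split=> // x; rewrite leq_eqVlt => /orP[/eqP jx|jx].
  by have -> : x = l by apply: val_inj; rewrite lj.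
by rewrite pp // qp.
Qed.

Lemma card_cell j p0 : 1 < j <= n -> 2 * #|cell j p0| = j`!.
Proof.
elim: j p0 => [//|[//|j] IH] p0 /andP[_ jn].
case: j IH jn => [|j] IH jn.
  (* With two free positions parity leaves a single word: [p0], or [p0] with these positions
     exchanged. *)
  suff [q ->] : exists q, cell 2 p0 = [set q] by rewrite cards1.
  pose q := if odd_perm p0 then (tperm i0 i1 * p0)%g else p0.
  have qc : q \in cell 2 p0.
    apply/cellP; rewrite /q; split; case op: (odd_perm p0); rewrite ?odd_permM ?odd_tperm ?op //.
    by move=> x x1; rewrite permM tpermD ?i0_neq ?i1_neq.
  exists q; apply/setP=> p; rewrite in_set1; apply/idP/eqP => [pc|->//].
  apply: even_perm_eq; first by rewrite (cell_even pc) (cell_even qc).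
  by case/cellP: pc qc => _ pp /cellP[_ qp] x x1; rewrite pp ?qp.
pose l := Ordinal jn.
have [q qc] : exists q, q \in cell j.+3 p0.
  have : 0 < #|cell j.+2 p0| by have := fact_gt0 j.+2; rewrite -(IH p0 (ltnW jn)); lia.
  case/card_gt0P=> q /cellP[oq qp]; exists q; apply/cellP; split=> // x jx.
  by rewrite qp // ltnW.
rewrite -(card_cell_pos (b := q l) (x := l)) ?mem_symbols //= -(cell_split (l := l)) //.
by rewrite mulnCA (IH _ (ltnW jn)) -factS.
Qed.

End Gen.

(** * Triangles, neighbourhoods and the induction statement *)

Section Triangles.
Variable m : nat.
Notation n := m.+4.
Notation T := {perm 'I_n}.
Notation i0 := (i0 m).
Notation i1 := (i1 m).
Implicit Types (p q r : T) (k l x b : 'I_n).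

(** Two distinct words of one orbit of [turn k], when [1 < k]; these orbits are the triangles. *)
Definition tri k p q := q = turn k p \/ p = turn k q.

Lemma tri_sym k p q : tri k p q -> tri k q p.
Proof. by case; [right|left]. Qed.

Lemma tri_trans k p q r : 1 < k -> tri k p q -> tri k q r -> p = r \/ tri k p r.
Proof.
move=> k1 [->|->] [->|]; rewrite /tri ?turn3 //; auto.
- by move/turn_inj; auto.
- by move->; right; left; rewrite turn3.
Qed.

Lemma tri_fix k p q x : 1 < x -> x != k -> tri k p q -> q x = p x.
Proof. by move=> x1 xk [->|->]; rewrite turn_fix. Qed.

Lemma tri_top k p q : 1 < k -> tri k p q -> q k = p i0 \/ q k = p i1.
Proof.
move=> k1 [->|->]; first by rewrite turn_k //; right.
by rewrite turn_0 //; left.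
Qed.

Lemma tri_odd k p q : 1 < k -> tri k p q -> odd_perm q = odd_perm p.
Proof. by move=> k1 [->|->]; rewrite odd_turn. Qed.

Lemma tri_top_neq k p q : 1 < k -> tri k p q -> q k != p k.
Proof.
by move=> k1 /(tri_top k1)[->|->]; rewrite (inj_eq perm_inj) ?i0_neq ?i1_neq.
Qed.

Lemma tri_neq k p q : 1 < k -> tri k p q -> p != q.
Proof. by move=> k1 /(tri_top_neq k1); apply: contra_neq => ->. Qed.

Lemma tri_eq k p q r : 1 < k -> tri k p q -> tri k p r -> q k = r k -> q = r.
Proof.
move=> k1 pq pr E; apply: even_perm_eq.
  by rewrite (tri_odd k1 pq) (tri_odd k1 pr).
move=> x x1; have [->//|xk] := eqVneq x k.
by rewrite (tri_fix x1 xk pq) (tri_fix x1 xk pr).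
Qed.

(** Among the positions above 1, an edge changes the symbol at its generator only. *)
Lemma tri_uniq k l p q : 1 < k -> 1 < l -> tri k p q -> tri l p q -> k = l.
Proof.
move=> k1 l1 /(tri_top_neq k1); have [//|kl] := eqVneq k l.
by move=> N /(tri_fix k1 kl) E; rewrite E eqxx in N.
Qed.

Lemma adj_irr j p : adj j p p = false.
Proof.
by apply/adjP => -[k [k1 _ /(tri_neq k1)]]; rewrite eqxx.
Qed.

Definition nb j p : {set T} := [set q | adj j p q].

Lemma card_nb j p : 1 < j <= n -> #|nb j p| = 2 * j - 4.
Proof.
case/andP=> j1 jn.
pose K := [set k : 'I_n | 1 < k < j].
have cK : #|K| = j - 2.
  have <- : j - 1 - 1 = j - 2 by lia.
  rewrite -{1}(card_symbols (1 : T)%g jn).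
  (* Adding positions 0 and 1 to [K] yields all positions below [j], and these are the symbols of
     the identity word. *)
  have -> : symbols j (1 : T)%g = i0 |: (i1 |: K).
    apply/setP=> x; rewrite !inE; apply/imsetP/idP.
      case=> y; rewrite inE => yj ->; rewrite perm1.
      by have [->|->|y1] := ord_cases y; rewrite ?eqxx ?orbT // y1 yj !orbT.
    move=> H; exists x; rewrite ?perm1 // inE.
    case/or3P: H => [/eqP->|/eqP->|/andP[]//]; [exact: leq_trans j1|exact: j1].
  by rewrite !cardsU1 !inE /= !add1n !subn1.
pose f (x : 'I_n * bool) := if x.2 then turn x.1 p else turn x.1 (turn x.1 p).
have ft (x : 'I_n * bool) : 1 < x.1 -> tri x.1 p (f x).
  by case: x => k [] /= k1; rewrite /f /tri /= ?turn3; auto.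
have E0 : nb j p = f @: (setX K setT).
  apply/setP=> q; rewrite inE; apply/adjP/imsetP.
    case=> k [k1 kj [->|pq]].
      by exists (k, true); rewrite // !inE k1 kj.
    by exists (k, false); rewrite /f /= ?pq ?turn3 // !inE k1 kj.
  case=> -[k c]; rewrite !inE andbT => /andP[k1 kj] ->; exists k; split=> //.
  exact: (ft (k, c)).
rewrite E0 card_in_imset ?cardsX ?cK ?cardsT ?card_bool; first by lia.
move=> [k c] [l d]; rewrite !inE !andbT => /andP[/= k1 kj] /andP[/= l1 lj] E.
have kl : k = l.
  by have := ft (l, d) l1; rewrite -E; apply: tri_uniq (ft (k, c) k1).
rewrite -{l l1 lj}kl in E *; congr (_, _).
case: c d E => [] [] //=; rewrite /f /= => /turn_inj E.
  by have /= := ft (k, true) k1; rewrite /f /= -E; move/(tri_neq k1); rewrite eqxx.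
by have /= := ft (k, true) k1; rewrite /f /= E; move/(tri_neq k1); rewrite eqxx.
Qed.

(* Two common neighbours [r <> r'] of nonadjacent words sit on a 4-cycle
   using two generators [k, l]; the symbols at positions 0, 1 of one word are
   then those at positions [k, l] of the other. *)
Lemma common_nb_uniq j p p' b r r' :
  p != p' -> ~~ adj j p p' ->
  b \in [:: p i0; p i1] -> b \in [:: p' i0; p' i1] ->
  adj j p r -> adj j p' r -> adj j p r' -> adj j p' r' -> r = r'.
Proof.
move=> pp' npp' bp bp'.
have sep k l s : 1 < k -> k < j -> 1 < l -> tri k p s -> tri l p' s -> k != l.
  move=> k1 kj l1 ks ls; apply/eqP=> kl; rewrite -{}kl in ls.
  case: (tri_trans k1 ks (tri_sym ls)) => [E|E]; first by rewrite E eqxx in pp'.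
  by case/negP: npp'; apply/adjP; exists k.
have move_p k l s x : 1 < k -> k < j -> 1 < l -> tri k p s -> tri l p' s -> 1 < x ->
    (p' x != p x) = (x == k) || (x == l).
  move=> k1 kj l1 ks ls x1; have kl := sep _ _ _ k1 kj l1 ks ls.
  have [->|xk] := eqVneq x k.
    by rewrite -(tri_fix k1 kl ls) (tri_top_neq k1 ks).
  have [->|xl] := eqVneq x l.
    by rewrite -(tri_fix l1 _ ks) 1?eq_sym // (tri_top_neq l1 ls).
  by rewrite -(tri_fix x1 xk ks) (tri_fix x1 xl ls) eqxx.
case/adjP=> k [k1 kj ks] /adjP[l [l1 lj ls]] /adjP[k' [k1' kj' ks']] /adjP[l' [l1' lj' ls']].
have kl := sep _ _ _ k1 kj l1 ks ls; have kl' := sep _ _ _ k1' kj' l1' ks' ls'.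
(* The positions above 1 where [p] and [p'] differ are the two generators of any path of length 2,
   so both paths use the same pair of generators. *)
have H x : 1 < x -> (x == k) || (x == l) = (x == k') || (x == l').
  by move=> x1; rewrite -(move_p _ _ _ _ k1 kj l1 ks ls x1) (move_p _ _ _ _ k1' kj' l1' ks' ls' x1).
have [kk|kk] := eqVneq k k'.
  rewrite -kk in ks' kl'; apply: (tri_eq k1 ks ks').
  by rewrite (tri_fix k1 kl ls) (tri_fix k1 kl' ls').
have k'l : k' = l.
  by apply/eqP; have := H _ k1'; rewrite eqxx /= eq_sym (negPf kk).
have l'k : l' = k.
  by have := H _ k1; rewrite eqxx (negPf kk) /= => /esym/eqP.
subst k' l'.
have pk : p' k = r k by rewrite (tri_fix k1 kl ls).
have pl : p' l = r' l by rewrite (tri_fix l1 kl' ls').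
have /eqP N : p' k != p' l by rewrite (inj_eq perm_inj).
have nb0 y : (y == k) || (y == l) -> (p' y != p' i0) && (p' y != p' i1).
  by case/orP=> /eqP ->; rewrite !(inj_eq perm_inj) !(eq_sym _ i0, eq_sym _ i1) ?i0_neq ?i1_neq.
(* The symbols of [p'] at [k] and [l] are the two at positions 0 and 1 of [p]. So [b] is one of
   them, while it also stands at position 0 or 1 of [p']. *)
have [y yk yb] : exists2 y, (y == k) || (y == l) & p' y = b.
  move: bp; rewrite !inE.
  case: (tri_top k1 ks) (tri_top l1 ks') => E [] E';
    rewrite -?pk -?pl in E E'; try by rewrite E E' in N.
    by case/orP=> /eqP ->; [exists k|exists l]; rewrite ?eqxx ?orbT.
  by case/orP=> /eqP ->; [exists l|exists k]; rewrite ?eqxx ?orbT.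
move: bp'; rewrite !inE -yb => bp'.
by have := nb0 _ yk; rewrite /= -negb_or bp'.
Qed.

(** Otherwise [q] would hold symbols of [B] at the four positions 0, 1, [l] and the generator of the
    edge, and [B] has only three. *)
Lemma adj_low_symbols j p q (l : 'I_n) (B : {set 'I_n}) :
  j <= l -> adj j p q -> #|B| <= 3 -> p i0 \in B -> p i1 \in B -> p l \in B ->
  ~~ ((q i0 \in B) && (q i1 \in B)).
Proof.
move=> jl /adjP[k [k1 kj pq]] B3 p0 p1 pl; apply/negP=> /andP[q0 q1].
have l1 : 1 < l by lia.
have lk : l != k by apply: contraTneq jl => ->; rewrite -ltnNge.
have : uniq (map q [:: i0; i1; k; l]).
  by rewrite (map_inj_uniq perm_inj) /= !inE (eq_sym k l) (negPf lk) ?(i0_neq k1) ?(i0_neq l1) (i1_neq k1) (i1_neq l1).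
move/uniq_leq_size/(_ (_ : {subset _ <= enum B})).
rewrite -cardE /= => H; suff: 4 <= #|B| by lia.
apply: H => x; rewrite mem_enum !inE => /or4P[] /eqP -> //.
  by case: (tri_top k1 pq) => ->.
by rewrite (tri_fix l1 lk pq).
Qed.

(** The predecessor sets one representative aside for the giant component. *)
Definition kbound j := forall p0 (S R : {set T}),
  separated (@adj m j) (cell j p0 :\: S) R -> #|R| <= 5 ->
  kap #|R|.-1 j <= #|cell j p0 :&: S|.

(** A word of this cell is determined by its symbol at position 2, and the triangle of [p] realises
    all three choices. *)
Lemma cell3_tri p0 p q (l : 'I_n) : val l = 2 ->
  p \in cell 3 p0 -> q \in cell 3 p0 -> p = q \/ tri l p q.
Proof.
move=> l2 pc qc; have l1 : 1 < l by rewrite l2.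
have : q l \in symbols 3 p.
  by rewrite (mem_symbols (p := q)) ?l2 // (cell_congr pc).
case/imsetP=> x; rewrite inE => x3 qx.
have opq : odd_perm p = odd_perm q by rewrite (cell_even pc) (cell_even qc).
have agree (y : 'I_n) : 1 < y -> y != l -> p y = q y.
  move=> y1 yl; case/cellP: pc qc => _ pp /cellP[_ qp].
  by rewrite pp ?qp //; move: yl; rewrite -val_eqE l2 /=; lia.
have ex r : odd_perm r = odd_perm p -> r l = q l -> tri l p r \/ p = r -> r = q.
  move=> opr rl pr; apply: even_perm_eq; first by rewrite opr.
  move=> y y1; have [->//|yl] := eqVneq y l; rewrite -agree //.
  by case: pr => [/(tri_fix y1 yl)|->].
have t1 : tri l p (turn l p) by left.
have t2 : tri l p (turn l (turn l p)) by right; rewrite turn3.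
have [Ex|Ex|x1] := ord_cases x.
- by right; rewrite -(ex _ (tri_odd l1 t2)) //; [rewrite !turn_k // turn_1 // qx Ex|left].
- by right; rewrite -(ex _ (tri_odd l1 t1)) //; [rewrite !turn_k // qx Ex|left].
left; apply: ex => //; last by right.
by rewrite qx; congr (p _); apply: val_inj; rewrite l2; apply/eqP; rewrite eqn_leq; apply/andP; split.
Qed.

Lemma kbound3 : kbound 3.
Proof.
move=> p0 S R [RW sep] _.
suff : #|R| <= 1 by case: #|R| => [|[|]].
apply/card_le1P=> p pR q; apply/idP/eqP => [qR|->//]; apply/esym.
have [/setDP[pc pS] /setDP[qc qS]] := (RW _ pR, RW _ qR).
have [//|t] := cell3_tri (l := @Ordinal n 2 isT) (erefl _) pc qc.
apply: sep => //; apply: connect_induced_step; rewrite ?in_setD ?pS ?qS //.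
by apply/adjP; exists (@Ordinal n 2 isT).
Qed.
End Triangles.

(** * Arithmetic of the bounds, and the inductive step in abstract form *)

Lemma kap_le N t : 3 < N -> t <= 4 -> kap t N.+1 <= 8 * N - 16.
Proof. by case: t => [|[|[|[|[|t]]]]] //=; lia. Qed.

(** For each of three bad copies, [s] is its number of deleted vertices, [x] its share of the
    components and [n] a part of [rest] charged to it. Without [charge] the sum falls two short
    exactly for the distributions (1,1,1) and (2,1,1). *)
Lemma kap_three_bad N rest sa sb sc na nb nc xa xb xc :
  3 < N -> xa + (xb + xc) <= 4 ->
  2 * N - 4 <= sa -> 2 * N - 4 <= sb -> 2 * N - 4 <= sc ->
  kap xa N <= sa -> kap xb N <= sb -> kap xc N <= sc ->
  na + (nb + nc) <= rest ->
  let charge x s n := (x = 1 -> 1 <= n) \/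
    (4 * N - 10 <= s \/ 2 * N - 4 + (xa + (xb + xc) - 1) <= rest + s) in
  charge xa sa na -> charge xb sb nb -> charge xc sc nc ->
  kap (xa + (xb + xc)) N.+1 <= rest + (sa + (sb + sc)).
Proof.
move=> N4 + + + + + + + + charge; rewrite /charge {charge}.
case: xa => [|[|[|[|[|xa]]]]]; case: xb => [|[|[|[|[|xb]]]]];
  case: xc => [|[|[|[|[|xc]]]]] //= _ ? ? ? ? ? ? ?; first [lia | intros; lia].
Qed.

(* [cp p] is the copy containing [p], [e'] is adjacency inside the copies, and
   [p], [o p], [o (o p)] is the triangle of [p] meeting three copies. *)
Section Step.
Variables (T I : finType) (V : {set T}) (e e' : rel T) (cp : T -> I).
Variables (o : T -> T) (A : {set I}) (N v M : nat).
Implicit Types (p q r u : T) (a b : I) (R U : {set T}).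

Definition copy a := [set p in V | cp p == a].

Hypothesis e_sym : symmetric e.
Hypothesis e'_sym : symmetric e'.
Hypothesis e'_irr : irreflexive e'.
Hypothesis o3 : forall p, o (o (o p)) = p.
Hypothesis oV : forall p, p \in V -> o p \in V.
Hypothesis cpA : forall p, p \in V -> cp p \in A.
Hypothesis cp_o : forall p, p \in V -> cp (o p) != cp p.
Hypothesis sub_e : subrel e' e.
Hypothesis e_o : forall p, p \in V -> e p (o p).
Hypothesis e'V : forall p q, p \in V -> e' p q -> q \in V /\ cp q = cp p.
Hypothesis cardA : #|A| = N.+1.
Hypothesis card_copy : forall a, a \in A -> #|copy a| = v.
Hypothesis card_matching : forall a b, a \in A -> b \in A -> a != b ->
  #|[set p in copy a | (cp (o p) == b) || (cp (o (o p)) == b)]| = M.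
Hypothesis IH : forall a (S R : {set T}), separated e' (copy a :\: S) R ->
  #|R| <= 5 -> kap #|R|.-1 N <= #|copy a :&: S|.
Hypothesis card_nbV : forall p, p \in V -> #|[set q | e' p q]| = 2 * N - 4.
Hypothesis common_nbV : forall p p' b, p \in V -> p' \in V -> p != p' -> ~~ e' p p' ->
  cp p = cp p' -> (cp (o p) == b) || (cp (o (o p)) == b) ->
  (cp (o p') == b) || (cp (o (o p')) == b) ->
  #|[set q | e' p q] :&: [set q | e' p' q]| <= 1.
Hypothesis nb_triple : forall (B : {set I}) p q, #|B| <= 3 -> p \in V -> e' p q ->
  cp p \in B -> cp (o p) \in B -> cp (o (o p)) \in B ->
  ~~ ((cp (o q) \in B) && (cp (o (o q)) \in B)).
Hypothesis card_triple : forall (B : {set I}) a, #|B| <= 3 -> a \in B ->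
  3 * #|[set p in copy a | (cp (o p) \in B) && (cp (o (o p)) \in B)]| <= #|copy a|.
Hypothesis N3 : 2 < N.
(** In the application [v] is N!/2 and [M] is (N-1)!. *)
Hypothesis vM3 : N = 3 -> v = 3 /\ M = 2.
Hypothesis vM4 : N = 4 -> v = 12 /\ M = 6.
Hypothesis vM5 : 5 <= N -> 12 * N <= v /\ 4 * N - 10 < M.

Lemma o_inj : injective o.
Proof. by move=> p q E; rewrite -(o3 p) E o3. Qed.

Lemma cp_oo p : p \in V -> cp (o (o p)) != cp p.
Proof. by move=> pV; rewrite eq_sym -{1}(o3 p) cp_o ?oV. Qed.

Lemma cp_o_oo p : p \in V -> cp (o (o p)) != cp (o p).
Proof. by move=> pV; rewrite cp_o ?oV. Qed.

Lemma e_oo p : p \in V -> e p (o (o p)).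
Proof. by move=> pV; rewrite e_sym -{2}(o3 p) e_o ?oV. Qed.

Lemma copyP a p : reflect (p \in V /\ cp p = a) (p \in copy a).
Proof. by rewrite inE; apply: (iffP andP) => -[-> /eqP]. Qed.

Section Cut.
Variable S : {set T}.
Let W := V :\: S.
Notation conn := (connect (induced_rel e W)).
Let s a := #|copy a :&: S|.

Lemma mem_W p : (p \in W) = (p \in V) && (p \notin S).
Proof. by rewrite in_setD andbC. Qed.

Lemma conn_sym : connect_sym (induced_rel e W).
Proof. exact: induced_connect_sym. Qed.

Lemma conn_o p : p \in V -> p \notin S -> o p \notin S -> conn p (o p).
Proof.
by move=> pV pS oS; apply: connect_induced_step; rewrite ?mem_W ?pV ?oV ?e_o.
Qed.

Lemma conn_oo p : p \in V -> p \notin S -> o (o p) \notin S -> conn p (o (o p)).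
Proof.
by move=> pV pS oS; apply: connect_induced_step; rewrite ?mem_W ?pV ?oV ?e_oo.
Qed.

Lemma card_cut_split (B : {set I}) :
  #|V :&: S| = #|[set p in V :&: S | cp p \notin B]| + \sum_(a in B) s a.
Proof.
rewrite (card_partition_fun _ cp) (bigID (mem B)) /= addnC; congr (_ + _).
  rewrite (card_partition_fun _ cp) [RHS](bigID (mem B)) /= [X in _ = X + _]big1 ?add0n.
    apply: eq_bigr => a aB; apply: eq_card => p; rewrite !inE.
    by case: eqP => [->|]; rewrite ?andbF // aB !andbT.
  move=> a aB; apply/eqP; rewrite cards_eq0; apply/set0Pn => -[p].
  by rewrite !inE => /andP[/andP[_ /negP na] /eqP E]; rewrite E in na.
apply: eq_bigr => a _; apply: eq_card => p; rewrite !inE.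
by case: (p \in V); case: (p \in S); rewrite ?andbF ?andbT.
Qed.

Lemma sum_copies : #|V :&: S| = \sum_(a in A) s a.
Proof.
rewrite (card_cut_split A); have -> : [set p in V :&: S | cp p \notin A] = set0.
  by apply/setP=> p; rewrite !inE; case pV: (p \in V); rewrite //= cpA ?andbF.
by rewrite cards0.
Qed.

(** Two unconnected vertices would form a separated pair, for which [IH] demands [kap 1 N]
    deletions. *)
Lemma good_conn a p q : s a < 2 * N - 4 ->
  p \in copy a :\: S -> q \in copy a :\: S -> conn p q.
Proof.
move=> sa pa qa; have [->//|pq] := eqVneq p q.
suff: connect (induced_rel e' (copy a :\: S)) p q.
  apply: connect_induced_sub => //; apply/subsetP=> x /setDP[/copyP[xV _] xS].
  by rewrite mem_W xV.
apply: contraLR sa => npq; rewrite -leqNgt.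
have := @IH a S [set p; q]; rewrite cards2 pq; apply=> //; split.
  by move=> x /set2P[] ->.
move=> x y /set2P[]-> /set2P[]-> //; rewrite ?(negPf npq) //.
by rewrite (induced_connect_sym e'_sym) (negPf npq).
Qed.

(** The [M] triangle edges between the two copies form a matching, so each deletion destroys at most
    one of them. *)
Lemma alive a b : a \in A -> b \in A -> a != b -> s a + s b < M ->
  exists p q, [/\ p \in copy a :\: S, q \in copy b :\: S & conn p q].
Proof.
move=> aA bA ab; rewrite -(card_matching aA bA ab); set E := [set _ in _ | _].
pose f p := if cp (o p) == b then o p else o (o p).
have fb p : p \in E -> f p \in copy b.
  rewrite inE /f => /andP[/copyP[pV _]]; case: eqP => [E1 _|_ /= /eqP E1];
  by apply/copyP; rewrite ?oV.
have finj : {in E &, injective f}.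
  move=> p q; rewrite !inE /f.
  case/andP=> /andP[pV /eqP pa] _ /andP[/andP[qV /eqP qa] _].
  case: ifP => _; case: ifP => _ /o_inj //.
  - by move=> pE; have := cp_o qV; rewrite -pE pa qa eqxx.
  - by move=> qE; have := cp_o pV; rewrite qE pa qa eqxx.
  by move/o_inj.
move=> lt; have [p pE /andP[pS fS]] : exists2 p, p \in E & (p \notin S) && (f p \notin S).
  apply/exists_inP; apply: contraLR lt; rewrite negb_exists_in -leqNgt => /forall_inP H.
  have -> : E = (E :&: S) :|: (E :\: S) by rewrite setID.
  apply: leq_trans (leq_card_setU _ _) _; apply: leq_add.
    apply: subset_leq_card; apply/subsetP=> p; rewrite !inE.
    by case/andP=> /andP[-> _] ->.
  have -> : #|E :\: S| = #|f @: (E :\: S)|.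
    rewrite card_in_imset // => p q /setDP[pE _] /setDP[qE _]; exact: finj.
  apply: subset_leq_card; apply/subsetP=> _ /imsetP[p /setDP[pE pS] ->].
  rewrite in_setI fb //=; have := H p pE; by rewrite pS /= negbK.
exists p, (f p); have /copyP[pV pa] : p \in copy a by move: pE; rewrite inE => /andP[].
split; rewrite ?in_setD ?fb ?pS ?fS //; first by rewrite inE pV pa eqxx.
by move: fS; rewrite /f; case: ifP => _ fS; [apply: conn_o|apply: conn_oo].
Qed.

(** * Vertices off the giant component and the deletions they force *)

Section Giant.
Variable w : T.
Hypothesis wW : w \in W.
Hypothesis giant : forall a p, a \in A -> s a < 2 * N - 4 -> p \in copy a :\: S -> conn w p.

Variable B : {set I}.
Hypothesis memB : forall a, (a \in B) = (a \in A) && (2 * N - 4 <= s a).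
Let X := [set p in W | ~~ conn w p].
Let rest := [set p in V :&: S | cp p \notin B].

Lemma mem_X p : p \in X -> [/\ p \in V, p \notin S & ~~ conn w p].
Proof. by rewrite inE mem_W => /andP[/andP[]]. Qed.

Lemma conn_X p q : p \in X -> conn p q -> q \in X.
Proof.
move=> pX pq; have [pV pS np] := mem_X pX.
have pW : p \in W by rewrite mem_W pV.
rewrite inE (connect_induced_mem e_sym pq) //=.
by apply: contra np => /connect_trans; apply; rewrite conn_sym.
Qed.

Lemma X_bad p : p \in X -> cp p \in B.
Proof.
case/mem_X=> pV pS np; rewrite memB cpA //= leqNgt; apply: contra np => sp.
by apply: giant sp _; rewrite ?cpA // in_setD pS; apply/copyP.
Qed.

Lemma bad_s a : a \in B -> a \in A /\ 2 * N - 4 <= s a.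
Proof. by rewrite memB => /andP. Qed.

(** If [o p] survived, it would be off the giant component together with [p], hence in a bad
    copy. *)
Lemma o_rest p : p \in X -> cp (o p) \notin B -> o p \in rest.
Proof.
move=> pX ob; have [pV pS np] := mem_X pX.
rewrite inE ob in_setI oV //= andbT; apply: contraR ob => oS.
by apply: X_bad; apply: conn_X pX _; apply: conn_o.
Qed.

Lemma oo_rest p : p \in X -> cp (o (o p)) \notin B -> o (o p) \in rest.
Proof.
move=> pX ob; have [pV pS np] := mem_X pX.
rewrite inE ob in_setI !oV //= andbT; apply: contraR ob => oS.
by apply: X_bad; apply: conn_X pX _; apply: conn_oo.
Qed.

(* Distinct elements of [U] in one component lie in one copy, whence
   their triangles towards other copies are disjoint. *)
Lemma rest_ge2 U U1 U2 :
  {subset U <= X} -> {in U &, forall u u', conn u u' -> cp u = cp u'} ->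
  U1 \subset U -> U2 \subset U ->
  {in U1, forall u, cp (o u) \notin B} -> {in U2, forall u, cp (o (o u)) \notin B} ->
  #|U1| + #|U2| <= #|rest|.
Proof.
move=> UX loose /subsetP s1 /subsetP s2 r1 r2.
rewrite -(card_imset U1 o_inj) -(card_imset U2 (inj_comp o_inj o_inj)).
have -> : #|o @: U1| + #|(o \o o) @: U2| = #|(o @: U1) :|: ((o \o o) @: U2)|.
  rewrite cardsU; suff -> : o @: U1 :&: (o \o o) @: U2 = set0 by rewrite cards0 subn0.
  apply/setP=> x; rewrite in_set0; apply/setIP => -[/imsetP[u uU ->] /imsetP[u' uU' /= /o_inj E]].
  have [uV uS _] := mem_X (UX _ (s1 _ uU)); have [uV' uS' _] := mem_X (UX _ (s2 _ uU')).
  (* A coincidence would make [u] equal to [o u']: connected to [u'] but in another copy. *)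
  have := cp_o uV'; rewrite -E; case/eqP; apply: loose; auto.
  rewrite conn_sym E; apply: conn_o => //; by rewrite -E.
apply: subset_leq_card; rewrite subUset; apply/andP; split.
  by apply/subsetP=> _ /imsetP[u uU ->]; apply: o_rest; auto.
by apply/subsetP=> _ /imsetP[u uU ->]; apply: oo_rest; auto.
Qed.

(** A vertex of a bad copy with this property has its whole triangle in bad copies, so its triangle
    charges nothing to [rest]. *)
Definition triple p := (cp (o p) \in B) && (cp (o (o p)) \in B).

(** Each [u] is charged to [o u] if that lies outside the bad copies, and to [o (o u)] otherwise. *)
Lemma rest_ge U : {subset U <= X} -> {in U &, forall u u', conn u u' -> cp u = cp u'} ->
  {in U, forall u, ~~ triple u} -> #|U| <= #|rest|.
Proof.
move=> UX loose nt.
rewrite -(cardsID [set u | cp (o u) \notin B] U).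
apply: (rest_ge2 UX loose); rewrite ?subsetIl ?subsetDl //.
  by move=> u; rewrite !inE => /andP[].
move=> u; rewrite !inE negbK => /andP[ob uU].
by have := nt _ uU; rewrite /triple ob.
Qed.

(** The vertex [z] of the giant component serves as one more representative, which makes up for the
    predecessor in [IH]. *)
Lemma kap_copy a z R : separated e W R -> R \subset X :&: copy a -> #|R| <= 4 ->
  z \in copy a :\: S -> z \notin X -> kap #|R| N <= s a.
Proof.
move=> [_ sep] /subsetP RX R4 za zX.
have zR : z \notin R by apply: contra zX => /RX /setIP[].
have := @IH a S (z |: R); rewrite cardsU1 zR /=; apply=> //.
have sub x y : connect (induced_rel e' (copy a :\: S)) x y -> conn x y.
  apply: connect_induced_sub => //; apply/subsetP=> u /setDP[/copyP[uV _] uS].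
  by rewrite mem_W uV.
split=> [x /setU1P[->//|/RX /setIP[/mem_X[_ xS _] xa]]|x y].
  by rewrite in_setD xS.
move=> /setU1P[->|xR] /setU1P[->|yR] // /sub c.
- by case/negP: zX; apply: conn_X (_ : conn y z); [case/setIP: (RX _ yR)|rewrite conn_sym].
- by case/negP: zX; apply: conn_X c; case/setIP: (RX _ xR).
exact: sep.
Qed.


Lemma triple_set p : p \in V -> cp p \in B -> triple p ->
  [set cp p; cp (o p); cp (o (o p))] \subset B /\
  #|[set cp p; cp (o p); cp (o (o p))]| = 3.
Proof.
move=> pV pB /andP[pB1 pB2]; split.
  by apply/subsetP=> x; rewrite !inE => /orP[/orP[]|] /eqP ->.
by rewrite setUC cardsU1 cards2 !inE negb_or (eq_sym (cp p)) ?cp_oo ?cp_o_oo ?cp_o ?oV.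
Qed.

Lemma triple_card p : p \in X -> triple p -> 2 < #|B|.
Proof.
move=> pX tp; have [pV _ _] := mem_X pX.
by case: (triple_set pV (X_bad pX) tp) => /subset_leq_card + <-.
Qed.

Lemma mem_triple p b : p \in X -> triple p -> #|B| = 3 -> b \in B -> cp p != b ->
  (cp (o p) == b) || (cp (o (o p)) == b).
Proof.
move=> pX tp B3 bB pb; have [pV _ _] := mem_X pX.
have [sub c3] := triple_set pV (X_bad pX) tp.
have /eqP E : [set cp p; cp (o p); cp (o (o p))] == B by rewrite eqEcard sub c3 B3.
by move: bB; rewrite -E !inE ![b == _]eq_sym (negPf pb).
Qed.

(** * Contradiction from a small cut with too many components off the giant one *)

Section Family.
Variable R : {set T}.
Hypothesis RX : {subset R <= X}.
Hypothesis sepR : separated e W R.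
Hypothesis R4 : #|R| <= 4.
Hypothesis N4 : 3 < N.
Hypothesis small : #|V :&: S| < kap #|R| N.+1.

Let x a := #|R :&: copy a|.

Lemma R_inj r r' : r \in R -> r' \in R -> conn r r' -> r = r'.
Proof. by case: sepR => _; apply. Qed.

(** Connected members of [U] are tied to the same member of [R], and so lie in its copy. This lets
    neighbours of [R] be charged along with [R]. *)
Lemma R_loose (U : {set T}) :
  {in U, forall u, exists r, [/\ r \in R, conn r u & cp r = cp u]} ->
  {subset U <= X} /\ {in U &, forall u u', conn u u' -> cp u = cp u'}.
Proof.
move=> H; split=> [u /H[r [rR ru _]]|u u' /H[r [rR ru <-]] /H[r' [rR' ru' <-]] uu'].
  by apply: conn_X ru; apply: RX.
congr cp; apply: R_inj => //; apply: connect_trans ru _.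
by apply: connect_trans uu' _; rewrite conn_sym.
Qed.

Lemma R_self r : r \in R -> exists r', [/\ r' \in R, conn r' r & cp r' = cp r].
Proof. by exists r. Qed.

Lemma card_X_split (U : {set T}) : {subset U <= X} ->
  #|U| = \sum_(a in B) #|U :&: copy a|.
Proof.
move=> UX; rewrite (card_partition_fun _ cp) (bigID (mem B)) /= [X in _ + X]big1 ?addn0.
  apply: eq_bigr => a _; apply: eq_card => p; rewrite !inE.
  case pU: (p \in U) => //=; by have [-> _ _] := mem_X (UX p pU).
move=> a aB; apply/eqP; rewrite cards_eq0; apply/set0Pn => -[p].
by rewrite inE => /andP[/UX /X_bad pB] /eqP E; rewrite -E pB in aB.
Qed.

Lemma sum_x : #|R| = \sum_(a in B) x a.
Proof. exact: card_X_split. Qed.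

Lemma sum_s : #|V :&: S| = #|rest| + \sum_(a in B) s a.
Proof. exact: card_cut_split. Qed.

Lemma small8 : #|V :&: S| < 8 * N - 16.
Proof. exact: leq_trans small (kap_le N4 R4). Qed.

Lemma sum_s_ge (D : {set I}) : D \subset B ->
  #|D| * (2 * N - 4) <= \sum_(a in D) s a.
Proof.
move=> /subsetP sD; rewrite -sum_nat_const; apply: leq_sum => a /sD.
by case/bad_s.
Qed.

(** Four bad copies would already contain [4 * (2 * N - 4) = 8 * N - 16] deleted vertices. *)
Lemma card_B : #|B| <= 3.
Proof.
have := small8; rewrite sum_s; have := sum_s_ge (subxx B); nia.
Qed.

(* Otherwise the vertices of the copy would need too many deleted neighbours
   in other copies. *)
Lemma copy_meets_giant a : a \in B -> exists2 z, z \in copy a :\: S & z \notin X.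
Proof.
move=> aB; have [aA sa] := bad_s aB.
apply/exists_inP; apply: contraT; rewrite negb_exists_in => /forall_inP H.
pose D := copy a :\: S.
have DX : {subset D <= X} by move=> z /H; rewrite negbK.
have Dcp z : z \in D -> cp z = a by case/setDP=> /copyP[].
have cD : #|D| + s a = v by rewrite addnC -(card_copy aA) cardsID.
have loose : {in D &, forall u u', conn u u' -> cp u = cp u'}.
  by move=> u u' /Dcp -> /Dcp ->.
have cardB := card_B.
pose Tr := [set p in copy a | triple p].
have cT : 3 * #|Tr| <= v by rewrite -(card_copy aA); apply: card_triple.
have DT : #|D| <= #|rest| + #|Tr|.
  rewrite -(cardsID Tr D) addnC; apply: leq_add; last exact/subset_leq_card/subsetIr.
  apply: rest_ge.
  - by move=> u /setDP[/DX].
  - by move=> u u' /setDP[uD _] /setDP[uD' _]; apply: loose.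
  move=> u /setDP[/setDP[ua _]]; by rewrite inE ua.
have := sum_s_ge (subsetDl B [set a]); rewrite cardsDS ?sub1set // cards1 => sB.
have := sum_s; rewrite (big_setD1 a) //= => sS.
have B0 : 0 < #|B| by apply/card_gt0P; exists a.
have sm8 := small8.
have vN : N = 4 /\ v = 12 \/ 5 <= N /\ 12 * N <= v.
  by case: (ltngtP N 4) N4 => // [N5 _|E _]; [right; case: (vM5 N5)|left; case: (vM4 E)].
have B2 : #|B| <= 2 -> #|D| <= #|rest|.
  move=> B2; apply: rest_ge => // u /DX uX.
  by apply/negP=> /(triple_card uX); rewrite ltnNge B2.
have B1 : #|B| = 1 -> 2 * #|D| <= #|rest| /\ #|R| <= #|D|.
  move/eqP/cards1P=> -[a' Ba]; have aa : a' = a by move: aB; rewrite Ba => /set1P.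
  rewrite {a'}aa in Ba; split.
    rewrite mul2n -addnn; apply: (rest_ge2 DX loose) => // u uD; rewrite Ba inE.
      by rewrite -(Dcp _ uD) cp_o //; case/mem_X: (DX _ uD).
    by rewrite -(Dcp _ uD) cp_oo //; case/mem_X: (DX _ uD).
  apply: subset_leq_card; apply/subsetP=> r /RX rX; have [rV rS _] := mem_X rX.
  by have := X_bad rX; rewrite Ba => /set1P ra; rewrite in_setD rS; apply/copyP.
have small' := small.
(* The other bad copies contain at least [2 * N - 4] deleted vertices each. For [N = 4] and [v = 12]
   there is no slack: with one bad copy, [small] is needed with the actual size of [R], which is at
   most that of [D]. *)
case: #|B| cardB B0 B2 B1 sB => [//|[|[|[|//]]]] _ _ B2 B1 sB.
- have [//|D2 RD] := B1; move: small' {B2 B1}.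
  case: vN => -[E1 E2]; last by lia.
  rewrite E1 /kap; case: #|R| R4 RD => [|[|[|[|[|]]]]] //; lia.
- have := B2 isT; lia.
- lia.
Qed.

Lemma kap_x a : a \in B -> kap (x a) N <= s a.
Proof.
move=> aB; have [z za zX] := copy_meets_giant aB.
apply: kap_copy za zX.
- exact: separatedS (subsetIl _ _) sepR.
- by apply/subsetP=> r /setIP[rR ra]; rewrite in_setI RX.
- exact: leq_trans (subset_leq_card (subsetIl _ _)) R4.
Qed.

Lemma e'_conn p q : p \in V -> p \notin S -> q \notin S -> e' p q -> conn p q.
Proof.
move=> pV pS qS pq; have [qV _] := e'V pV pq.
by apply: connect_induced_step; rewrite ?mem_W ?pV ?qV //; apply: sub_e.
Qed.

Lemma R_mem r : r \in R -> [/\ r \in V, r \notin S & r \in X].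
Proof. by move=> /RX rX; have [rV rS _] := mem_X rX. Qed.

(** If one of the two members in copy [a] has no triangle vertex in copy [b], it charges [rest]
    twice. Otherwise they have at most one common neighbour, hence at least [4 * N - 9] neighbours
    in copy [a]. Each of these is deleted there or charges [rest], besides the three members of
    [R]. *)
Lemma two_bad_special a b : a != b -> B = [set a; b] -> x a = 2 -> #|R| = 3 ->
  4 <= #|rest| \/ 4 * N - 6 <= #|rest| + s a.
Proof.
move=> ab BE /eqP/cards2P[p1 [p2 [p12 RE]]] cR.
have pR p : p \in [set p1; p2] -> p \in R /\ cp p = a.
  by rewrite -RE => /setIP[pR /copyP[_ ->]].
have nt u : u \in X -> ~~ triple u.
  by move=> uX; apply/negP=> /(triple_card uX); rewrite BE cards2; case: (a != b).
have [p1R p1a] := pR _ (set21 p1 p2); have [p2R p2a] := pR _ (set22 p1 p2).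
pose share p := (cp (o p) == b) || (cp (o (o p)) == b).
have [[p [pP np]]|/andP[sh1 sh2]] :
    (exists p, p \in [set p1; p2] /\ ~~ share p) \/ share p1 && share p2.
  case sh1: (share p1); last by left; exists p1; rewrite set21 sh1.
  case sh2: (share p2); last by left; exists p2; rewrite set22 sh2.
  by right.
- left; have [pR' pa] := pR _ pP; have [pV _ _] := R_mem pR'.
  have [_ loose] := R_loose R_self.
  pose U1 := [set r in R | cp (o r) \notin B].
  pose U2 := [set r in R | cp (o (o r)) \notin B].
  apply: leq_trans (_ : #|U1| + #|U2| <= _); last first.
    by apply: (rest_ge2 RX loose);
      [apply/subsetP=> r /setIdP[]|apply/subsetP=> r /setIdP[]|move=> r /setIdP[]|move=> r /setIdP[]].
  have UR : U1 :|: U2 = R.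
    apply/setP=> r; apply/setUP/idP => [[] /setIdP[]//|rR].
    have := nt _ (RX rR); rewrite negb_and => /orP[H|H]; [left|right]; exact/setIdP.
  (* The union of [U1] and [U2] is [R], of size 3, and [p] lies in their intersection. *)
  rewrite -cardsUI UR cR -[4]addn1 leq_add2l; apply/card_gt0P; exists p.
  move: np; rewrite negb_or => /andP[n1 n2].
  rewrite in_setI; apply/andP; split; apply/setIdP; split=> //; rewrite BE !inE negb_or.
    by rewrite n1 -pa cp_o.
  by rewrite n2 -pa cp_oo.
- right; pose Nb := [set q | e' p1 q] :|: [set q | e' p2 q].
  have [[p1V p1S _] [p2V p2S _]] := (R_mem p1R, R_mem p2R).
  have ne12 : ~~ e' p1 p2.
    by apply/negP=> /(e'_conn p1V p1S p2S)/(R_inj p1R p2R)/eqP; rewrite (negPf p12).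
  have cNb : 4 * N - 9 <= #|Nb|.
    have := @common_nbV p1 p2 b p1V p2V p12 ne12; rewrite p1a p2a => /(_ erefl sh1 sh2).
    rewrite cardsU !card_nbV // => le1.
    by move: #|_ :&: _| le1 N4 => k; clear; lia.
  have NbE q : q \in Nb -> exists p, [/\ p \in R, cp p = a & e' p q].
    by case/setUP; rewrite inE => E; [exists p1|exists p2].
  have NbP q : q \in Nb :\: S -> exists r, [/\ r \in R, conn r q & cp r = cp q].
    case/setDP=> /NbE[p [pR' _ pq]] qS; have [pV pS _] := R_mem pR'.
    by exists p; split=> //; [apply: e'_conn|case: (e'V pV pq)].
  have UP : {in R :|: (Nb :\: S), forall u, exists r, [/\ r \in R, conn r u & cp r = cp u]}.
    by move=> u /setUP[/R_self|/NbP].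
  have [UX loose] := R_loose UP.
  have := rest_ge UX loose (fun u uU => nt u (UX u uU)).
  rewrite cardsU; have -> : R :&: (Nb :\: S) = set0.
    apply/setP=> q; rewrite in_set0; apply/setIP => -[qR /setDP[/NbE[p [pR' _ pq]] qS]].
    have [pV pS _] := R_mem pR'.
    by have := R_inj pR' qR (e'_conn pV pS qS pq) => E; rewrite E e'_irr in pq.
  rewrite cards0 subn0 cR => le1.
  have le2 : #|Nb :&: S| <= s a.
    apply: subset_leq_card; apply/subsetP=> q /setIP[/NbE[p [pR' pa pq]] qS].
    have [pV _ _] := R_mem pR'; have [qV qp] := e'V pV pq.
    by rewrite in_setI qS andbT; apply/copyP; rewrite qp.
  move: (cardsID S Nb) cNb le1 le2.
  move: #|Nb| #|Nb :&: S| #|Nb :\: S| #|rest| (s a); clear; lia.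
Qed.

(* Each family member other than [rb] is charged either a vertex of [rest] or
   a deleted vertex of copy [b] which is not a neighbour of [rb]. *)
Lemma three_bad_charge b rb : #|B| = 3 -> b \in B -> R :&: copy b = [set rb] -> triple rb ->
  4 * N - 10 <= s b \/ 2 * N - 4 + (#|R| - 1) <= #|rest| + s b.
Proof.
move=> B3 bB RE trb.
have [rbR rbb] : rb \in R /\ cp rb = b.
  by have := set11 rb; rewrite -RE => /setIP[? /copyP[]].
have [rbV rbS rbX] := R_mem rbR.
pose f r := if cp (o r) == b then o r else o (o r).
pose Tr := [set r in R :\ rb | triple r].
pose nT := [set r in R :\ rb | ~~ triple r].
have TrP r : r \in Tr -> [/\ r \in R, r != rb, cp r != b & triple r].
  case/setIdP=> /setD1P[rrb rR] tr; split=> //; apply: contra rrb => /eqP rb'.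
  have [rV _ _] := R_mem rR.
  by rewrite -in_set1 -RE in_setI rR; apply/copyP.
have fP r : r \in Tr -> [/\ f r \in V, cp (f r) = b, triple (f r) & f r \notin S -> conn r (f r)].
  case/TrP=> rR _ rb' tr; have [rV rS rX] := R_mem rR.
  have := mem_triple rX tr B3 bB rb'; have := X_bad rX; move: tr; rewrite /triple /f.
  case/andP=> t1 t2 t0; case: eqP => [E _|_ /= /eqP E].
    by split; rewrite ?oV ?o3 ?t2 //; apply: conn_o.
  by split; rewrite ?oV ?o3 ?t1 ?t0 //; apply: conn_oo.
(* If the triangle vertex [f r] in copy [b] survives, it represents a second component off the giant
   one there, and [kap 2 N] applies. *)
have [/exists_inP[r rT frS]|] := boolP [exists r in Tr, f r \notin S].
  left; have [rR rrb _ _] := TrP _ rT; have [fV fb _ /(_ frS) cf] := fP _ rT.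
  have fX : f r \in X by apply: conn_X cf; apply: RX.
  have nrb : ~~ conn rb (f r).
    apply/negP=> c; case/eqP: rrb; apply: R_inj => //.
    by apply: connect_trans cf _; rewrite conn_sym.
  have rbf : rb != f r by apply: contraNneq nrb => ->; rewrite connect0.
  have [z zb zX] := copy_meets_giant bB.
  have := @kap_copy b z [set rb; f r]; rewrite cards2 rbf; apply=> //.
    split=> [u /set2P[]->|u u' /set2P[]-> /set2P[]-> //]; rewrite ?mem_W ?rbV ?fV //.
      by move=> c; rewrite c in nrb.
    by rewrite conn_sym => c; rewrite c in nrb.
  by apply/subsetP=> u /set2P[]->; rewrite in_setI ?rbX ?fX; apply/copyP.
rewrite negb_exists_in => /forall_inP fS; right.
have finj : {in Tr &, injective f}.
  move=> r r' rT rT' E; have [rR _ _ _] := TrP _ rT; have [rR' _ _ _] := TrP _ rT'.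
  have [[rV rS _] [rV' rS' _]] := (R_mem rR, R_mem rR').
  move: E; rewrite /f; case: ifP => _; case: ifP => _ /o_inj //.
  - by move=> E; apply: R_inj; rewrite // conn_sym E; apply: conn_o; rewrite // -E.
  - by move=> E; apply: R_inj; rewrite // -E; apply: conn_o; rewrite // E.
  by move/o_inj.
pose Nb := [set q | e' rb q].
have NbP q : q \in Nb -> [/\ q \in V, cp q = b, ~~ triple q & q \notin S -> conn rb q].
  rewrite inE => rq; have [qV qb] := e'V rbV rq; split=> //.
  - by rewrite qb.
  - case/andP: trb => t1 t2; by apply: nb_triple rbV rq _ t1 t2; rewrite ?B3 ?rbb.
  by move=> qS; apply: e'_conn.
have le_b : #|Nb :&: S| + #|Tr| <= s b.
  rewrite -(card_in_imset finj).
  have -> : #|Nb :&: S| + #|f @: Tr| = #|(Nb :&: S) :|: f @: Tr|.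
    (* Neighbours of [rb] are not triples by [nb_triple], whereas every [f r] is one. *)
    rewrite cardsU; suff -> : Nb :&: S :&: f @: Tr = set0 by rewrite cards0 subn0.
    apply/setP=> q; rewrite in_set0; apply/setIP => -[/setIP[/NbP[_ _ nt _] _]].
    by case/imsetP=> r /fP[_ _ tr _] E; rewrite E tr in nt.
  apply: subset_leq_card; rewrite subUset; apply/andP; split.
    apply/subsetP=> q /setIP[/NbP[qV qb _ _] qS]; rewrite in_setI qS andbT; exact/copyP.
  apply/subsetP=> _ /imsetP[r rT ->]; have [fV fb _ _] := fP _ rT.
  by rewrite in_setI -[_ \in S]negbK fS // andbT; apply/copyP.
have le_rest : #|nT| + #|Nb :\: S| <= #|rest|.
  have -> : #|nT| + #|Nb :\: S| = #|nT :|: (Nb :\: S)|.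
    rewrite cardsU; suff -> : nT :&: (Nb :\: S) = set0 by rewrite cards0 subn0.
    apply/setP=> q; rewrite in_set0; apply/setIP => -[/setIdP[/setD1P[qrb qR] _]].
    by case/setDP=> /NbP[_ _ _ c] /c /(R_inj rbR qR) E; rewrite E eqxx in qrb.
  have UP : {in nT :|: (Nb :\: S), forall u, exists r, [/\ r \in R, conn r u & cp r = cp u]}.
    move=> u /setUP[/setIdP[/setD1P[_ uR] _]|/setDP[/NbP[_ ub _ c] uS]].
      exact: R_self.
    by exists rb; split=> //; [apply: c|rewrite ub].
  have [UX loose] := R_loose UP; apply: rest_ge => // u /setUP[/setIdP[]//|].
  by case/setDP=> /NbP[].
have cR : #|Tr| + #|nT| = #|R| - 1.
  rewrite (cardsD1 rb R) rbR add1n subn1 /= -(cardsID [set r | triple r] (R :\ rb)).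
  by congr (_ + _); apply: eq_card => r; rewrite !inE // [RHS]andbC.
have := card_nbV rbV; rewrite -/Nb -(cardsID S Nb); lia.
Qed.

(** Adding the bounds for the two copies to [#|R|] suffices except for the distribution (2,1), which
    is one short; [two_bad_special] supplies the missing vertex. *)
Lemma two_bad a b : a != b -> B = [set a; b] -> False.
Proof.
move=> ab BE; have [aB bB] : a \in B /\ b \in B by rewrite BE set21 set22.
have sx := sum_x; rewrite BE big_setU1 ?inE // big_set1 in sx.
have ss := sum_s; rewrite BE big_setU1 ?inE // big_set1 in ss.
have [[_ sa] [_ sb]] := (bad_s aB, bad_s bB).
have [ka kb] := (kap_x aB, kap_x bB).
have le_rest : #|R| <= #|rest|.
  have [_ loose] := R_loose R_self; apply: rest_ge => // u /RX uX.
  by apply/negP=> /(triple_card uX); rewrite BE cards2; case: (a != b).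
have sp1 := two_bad_special ab BE.
have ba : b != a by rewrite eq_sym.
have sp2 := two_bad_special ba (etrans BE (setUC _ _)).
have := small; rewrite ss.
move: R4 sx le_rest sp1 sp2 ka kb => {}/[swap] -> + + + +.
case: (x a) => [|[|[|[|[|//]]]]]; case: (x b) => [|[|[|[|[|//]]]]] //=; lia.
Qed.


(** Every member of [R] charges [rest] twice, and [2 * #|R|] is the growth of [kap #|R|] from [N] to
    [N.+1]. *)
Lemma one_bad a : B = [set a] -> False.
Proof.
move=> BE; have aB : a \in B by rewrite BE set11.
have sx := sum_x; rewrite BE big_set1 in sx.
have ss := sum_s; rewrite BE big_set1 in ss.
have ka := kap_x aB.
have Rcp r : r \in R -> cp r = a by move/RX/X_bad; rewrite BE => /set1P.
have le_rest : #|R| + #|R| <= #|rest|.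
  have [_ loose] := R_loose R_self.
  apply: (rest_ge2 RX loose) => // r rR; have [rV _ _] := R_mem rR.
    by rewrite BE inE -(Rcp r rR) cp_o.
  by rewrite BE inE -(Rcp r rR) cp_oo.
have := small; rewrite ss.
move: R4 sx le_rest ka => {}/[swap] -> + +.
case: (x a) => [|[|[|[|[|//]]]]] //=; lia.
Qed.

Lemma three_bad a b c : a != b -> a != c -> b != c -> B = a |: [set b; c] -> False.
Proof.
move=> ab ac bc BE; have aN : a \notin [set b; c] by rewrite !inE negb_or ab.
have bN : b \notin [set c] by rewrite inE.
have [aB bB cB] : [/\ a \in B, b \in B & c \in B].
  by rewrite BE !inE !eqxx !orbT.
have sum3 (F : I -> nat) : \sum_(y in B) F y = F a + (F b + F c).
  by rewrite BE big_setU1 // big_setU1 // big_set1.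
have sx := sum_x; rewrite sum3 in sx.
have ss := sum_s; rewrite sum3 in ss.
have [[_ sa] [_ sb] [_ sc]] := And3 (bad_s aB) (bad_s bB) (bad_s cB).
have [ka kb kc] := And3 (kap_x aB) (kap_x bB) (kap_x cB).
pose U := [set r in R | ~~ triple r].
have UR : {subset U <= R} by move=> r /setIdP[].
have le_rest : #|U :&: copy a| + (#|U :&: copy b| + #|U :&: copy c|) <= #|rest|.
  rewrite -(sum3 (fun y => #|U :&: copy y|)) -card_X_split; last by move=> r /UR/RX.
  have [UX loose] := R_loose (fun r rU => R_self (UR r rU)).
  by apply: rest_ge => // r /setIdP[].
have B3 : #|B| = 3 by rewrite BE cardsU1 aN cards2 bc.
have charge y : y \in B -> (x y = 1 -> 1 <= #|U :&: copy y|) \/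
    (4 * N - 10 <= s y \/ 2 * N - 4 + (#|R| - 1) <= #|rest| + s y).
  move=> yB; have [x1|x1] := eqVneq (x y) 1; last by left=> E; rewrite E in x1.
  have [r Rr] := cards1P (introT eqP x1).
  (* A lone member of [R] in a copy either is a triple, covered by [three_bad_charge], or charges
     [rest] itself. *)
  have [tr|ntr] := boolP (triple r).
    by right; apply: three_bad_charge tr.
  left=> _; apply/card_gt0P; exists r.
  by have := set11 r; rewrite -Rr !in_setI => /andP[rR ->]; rewrite andbT; apply/setIdP.
rewrite sx in charge.
have := small; rewrite ss ltnNge sx => /negP; apply.
apply: kap_three_bad sa sb sc ka kb kc le_rest _ _ _ => //; last 3 first.
- exact: charge.
- exact: charge.
- exact: charge.
by rewrite -sx.
Qed.

Lemma family_absurd : False.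
Proof.
have := card_B; case E: #|B| => [|[|[|[|//]]]] _.
- have := small; rewrite sum_x; move/eqP: E; rewrite cards_eq0 => /eqP ->.
  by rewrite big_set0.
- by move/eqP/cards1P: E => [a /one_bad].
- by move/eqP/cards2P: E => [a [b [ab /two_bad]]]; apply.
have /card_gt0P[a aB] : 0 < #|B| by rewrite E.
have : #|B :\ a| == 2 by move: E; rewrite (cardsD1 a) aB add1n => -[->].
case/cards2P=> b [c [bc Ba]].
have : b \in B :\ a by rewrite Ba set21.
have : c \in B :\ a by rewrite Ba set22.
case/setD1P=> ca _ /setD1P[ba _].
apply: (@three_bad a b c); rewrite // 1?eq_sym //; by rewrite -Ba setD1K.
Qed.

End Family.


End Giant.

(** * Existence of the giant component, and conclusion of the step *)

Lemma min_copy : exists g, [/\ g \in A, N.+1 * s g <= #|V :&: S| &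
  {in A, forall a, s g <= s a}].
Proof.
have /card_gt0P[a0 a0A] : 0 < #|A| by rewrite cardA.
case: (arg_minnP s a0A) => g gA gmin; exists g; split=> //.
by rewrite sum_copies -cardA -sum_nat_const; apply: leq_sum => a /gmin.
Qed.

(** The component is built around [g]: every other good copy keeps an edge to it by [alive]. *)
Lemma giant_exists g : g \in A -> s g < v -> s g < 2 * N - 4 ->
  {in A, forall a, s a < 2 * N - 4 -> a != g -> s a + s g < M} ->
  exists2 w, w \in W & forall a p, a \in A -> s a < 2 * N - 4 -> p \in copy a :\: S -> conn w p.
Proof.
move=> gA gv gs near.
have /card_gt0P[w wg] : 0 < #|copy g :\: S|.
  by have := cardsID S (copy g); rewrite card_copy // -/(s g); lia.
exists w.
  by case/setDP: (wg) => /copyP[wV _] wS; rewrite mem_W wV.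
move=> a p aA sa pa; have [ag|ag] := eqVneq a g.
  by apply: good_conn gs wg _; rewrite -ag.
have [p' [q' [p'a q'g pq]]] := alive aA gA ag (near a aA sa ag).
apply: connect_trans (good_conn gs wg q'g) _.
by apply: connect_trans (good_conn sa p'a pa); rewrite conn_sym.
Qed.

(** At most one representative lies in the component of [w]. *)
Lemma off_giant w R : separated e W R ->
  exists R', [/\ separated e W R', {subset R' <= [set p in W | ~~ conn w p]} & #|R'| = #|R|.-1].
Proof.
move=> sepR; have [RW sep] := sepR; set X := [set p in W | _].
have leX : #|R|.-1 <= #|R :&: X|.
  suff : #|R :\: X| <= 1 by have := cardsID X R; lia.
  have near x : x \in R -> x \notin X -> conn w x.
    by move=> xR; rewrite inE RW //= negbK.
  apply/card_le1P=> p /setDP[pR pX] q; apply/idP/eqP => [/setDP[qR qX]|->].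
    by apply: sep => //; apply: connect_trans (near p pR pX); rewrite conn_sym near.
  by rewrite in_setD pR pX.
have [R' sR' cR'] := subset_of_card leX; exists R'; split=> //.
  exact: separatedS (subset_trans sR' (subsetIl _ _)) sepR.
by move=> x /(subsetP sR') /setIP[].
Qed.

Lemma step_bound R : 3 < N -> separated e W R -> #|R| <= 5 ->
  kap #|R|.-1 N.+1 <= #|V :&: S|.
Proof.
move=> N4 sepR R5; rewrite leqNgt; apply/negP=> small.
have R4 : #|R|.-1 <= 4 by lia.
have small8 := leq_trans small (kap_le N4 R4).
have no_giant w : w \in W ->
    (forall a p, a \in A -> s a < 2 * N - 4 -> p \in copy a :\: S -> conn w p) -> False.
  move=> wW giant; have [R' [sepR' R'X cR']] := off_giant w sepR.
  apply: (family_absurd (B := [set a in A | 2 * N - 4 <= s a]) wW giant _ R'X sepR');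
    by rewrite ?cR' // => a; rewrite inE.
have [g [gA gS gmin]] := min_copy.
have g7 : s g < 8 by nia.
have [gv gs] : s g < v /\ s g < 2 * N - 4.
  case: (ltngtP N 4) N4 => // [N5 _|E _].
    by have [v12 _] := vM5 N5; split; nia.
  by have [-> _] := vM4 E; rewrite E in gS small8 *; split; lia.
have [/forall_inP H|] := boolP [forall a in A, [&& s a < 2 * N - 4 & a != g] ==> (s a + s g < M)].
  have [a aA sa ag|w wW] := giant_exists gA gv gs; last exact: no_giant.
  by have := H a aA; rewrite sa ag.
rewrite negb_forall_in => /exists_inP[a aA].
rewrite negb_imply -leqNgt => /andP[/andP[sa _] Ma].
(* Two good copies have at most [4 * N - 10] deleted vertices together, which is below [M] as soon
   as [N] is at least 5. *)
have N_4 : N = 4.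
  case: (ltngtP N 4) N4 => // N5 _; have [_ M5] := vM5 N5; lia.
have [v12 M6] := vM4 N_4; rewrite N_4 in small8 small sa gS.
have g3 : 3 <= s g by lia.
have cut_le (D : {set I}) : D \subset A -> #|D| * 3 <= \sum_(b in D) s b.
  by move=> /subsetP DA; rewrite -sum_nat_const; apply: leq_sum => b /DA /gmin; apply: leq_trans.
(* Each of the five copies has at least three deleted vertices, and there are fewer than 16 in
   all. *)
have s3 : {in A, forall b, s b = 3}.
  move=> b bA; have := cut_le _ (subsetDl A [set b]).
  have := sum_copies; rewrite (big_setD1 b) //=.
  have := cardsD1 b A; rewrite bA cardA N_4 add1n => -[<-].
  have := gmin b bA; lia.
have s15 : #|V :&: S| = 15.
  by rewrite sum_copies (eq_bigr _ s3) sum_nat_const cardA N_4.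
(* Of the bounds 0, 6, 10, 14, 16 only the last exceeds 15. *)
have R_5 : #|R| = 5.
  by move: small; rewrite s15; case: #|R| R5 => [|[|[|[|[|[|]]]]]].
have [RW sep] := sepR.
have same p q : p \in W -> q \in W -> cp p = cp q -> conn p q.
  move=> /setDP[pV pS] /setDP[qV qS] E; apply: (@good_conn (cp p)).
  - by rewrite s3 ?cpA ?N_4.
  - by rewrite in_setD pS; apply/copyP.
  - by rewrite in_setD qS; apply/copyP.
have cp_inj : {in R &, injective cp}.
  by move=> p q pR qR E; apply: sep => //; apply: same => //; apply: RW.
have cpR b : b \in A -> exists2 r, r \in R & cp r = b.
  move=> bA; have /eqP E : cp @: R == A.
    rewrite eqEcard card_in_imset // cardA N_4 R_5 leqnn andbT.
    by apply/subsetP=> _ /imsetP[r /RW/setDP[rV _] ->]; apply: cpA.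
  by move: bA; rewrite -E => /imsetP[r rR ->]; exists r.
(* Each component is a single copy, so both outer neighbours of every
   surviving vertex of a copy are deleted. *)
have cut p q : p \in W -> q \in V -> cp q != cp p -> (q \notin S -> conn p q) -> q \in S.
  move=> pW qV npq c; apply: contraR npq => qS.
  have qW : q \in W by rewrite mem_W qV.
  have pV : p \in V by case/setDP: pW.
  have [[r rR rp] [r' rR' rq]] := (cpR _ (cpA pV), cpR _ (cpA qV)).
  rewrite -rp -rq; apply/eqP; congr cp; apply/esym; apply: sep => //.
  apply: connect_trans (same _ _ (RW _ rR) pW rp) _.
  by apply: connect_trans (c qS) _; apply: same; rewrite ?rq ?(RW _ rR').
pose D := copy g :\: S.
have DP p : p \in D -> [/\ p \in W, p \in V, p \notin S & cp p = g].
  by case/setDP=> /copyP[pV pg] pS; rewrite mem_W pV.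
have cD : #|D| = 9.
  by have := cardsID S (copy g); rewrite card_copy // v12 -/(s g) s3 //; rewrite -/D; lia.
(* The nine survivors of copy [g] have 18 distinct outer neighbours, all deleted, against 15
   deletions. *)
suff : #|o @: D :|: (o \o o) @: D| <= #|V :&: S|.
  rewrite cardsU (_ : _ :&: _ = set0) ?cards0 ?subn0.
    by rewrite (card_imset D o_inj) (card_imset D (inj_comp o_inj o_inj)) cD s15.
  apply/setP=> q; rewrite in_set0; apply/setIP=> -[/imsetP[p pD ->] /imsetP[p' pD' /o_inj E]].
  have [_ _ _ pg] := DP p pD; have [_ pV _ pg'] := DP p' pD'.
  by have := cp_o pV; rewrite -E pg pg' eqxx.
apply: subset_leq_card; rewrite subUset; apply/andP; split.
  apply/subsetP=> _ /imsetP[p /DP[pW pV pS _] ->]; rewrite in_setI oV //=.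
  by apply: (cut p) => //; rewrite ?oV ?cp_o // => oS; apply: conn_o.
apply/subsetP=> _ /imsetP[p /DP[pW pV pS _] ->]; rewrite in_setI /= !oV //=.
by apply: (cut p) => //; rewrite ?oV ?cp_oo // => oS; apply: conn_oo.
Qed.

(** Three deletions leave one of the four triangles untouched, and the giant component grows from
    it. A vertex [r] off it lies in a copy with two deletions, and both its outer neighbours are
    deleted too, four in all. *)
Lemma step_bound3 R : N = 3 -> separated e W R -> #|R| <= 2 ->
  kap #|R|.-1 N.+1 <= #|V :&: S|.
Proof.
move=> N_3 sepR R2; rewrite N_3; case cR: #|R| R2 => [|[|[|]]] //= _.
rewrite leqNgt; apply/negP=> small.
have [v3 M2] := vM3 N_3.
have [g [gA gS gmin]] := min_copy; rewrite N_3 in gS.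
have sg0 : s g = 0 by lia.
have [||a aA sa ag|w wW giant] := @giant_exists g gA; rewrite ?sg0 ?v3 ?N_3 //.
  by rewrite M2 addn0; rewrite N_3 in sa.
have [R' [_ R'X cR']] := off_giant w sepR.
have /card_gt0P[r /R'X rX] : 0 < #|R'| by rewrite cR' cR.
have [rV rS _] := mem_X rX.
have Xb p : p \in [set p in W | ~~ conn w p] -> 2 * N - 4 <= s (cp p).
  have memB a : (a \in [set a in A | 2 * N - 4 <= s a]) = (a \in A) && (2 * N - 4 <= s a).
    by rewrite inE.
  by move=> pX; have := X_bad giant memB pX; rewrite inE => /andP[].
have bad b : b \in A -> 2 * N - 4 <= s b -> b = cp r.
  move=> bA sb; apply/eqP; apply: contraTT small => nb; rewrite -leqNgt.
  have := Xb r rX.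
  rewrite sum_copies (big_setD1 (cp r)) ?cpA //= (big_setD1 b) ?in_setD1 ?nb //=.
  rewrite N_3 in sb *; lia.
have outS q : q \in V -> cp q != cp r -> (q \notin S -> conn r q) -> q \in S.
  move=> qV qr c; apply: contraR qr => /c rq; apply/eqP.
  by apply: bad; [apply: cpA|apply: Xb; apply: conn_X rX rq].
have oS : o r \in S by apply: outS; rewrite ?oV ?cp_o // => oS; apply: conn_o.
have ooS : o (o r) \in S by apply: outS; rewrite ?oV ?cp_oo // => ooS; apply: conn_oo.
have oo : o r != o (o r) by apply: contraTneq (cp_o rV) => /o_inj <-; rewrite eqxx.
have : 4 <= #|V :&: S|; last by rewrite leqNgt small.
rewrite -(cardsID (copy (cp r))) -[4]/(2 + 2); apply: leq_add.
  apply: leq_trans (_ : s (cp r) <= _); first by have := Xb r rX; rewrite N_3.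
  apply: subset_leq_card; apply/subsetP=> p /setIP[pr pS].
  by rewrite !in_setI pr pS; case/copyP: pr => ->.
apply: leq_trans (_ : #|[set o r; o (o r)]| <= _); first by rewrite cards2 oo.
apply: subset_leq_card; apply/subsetP=> p /set2P[]->.
  by rewrite in_setD in_setI oS !oV // inE oV // cp_o.
by rewrite in_setD in_setI ooS !oV // inE !oV // cp_oo.
Qed.





End Cut.
End Step.

(** * The abstract step applied to the cells of level [j.+1] *)

Section Induction.
Variables (m j : nat) (p0 : {perm 'I_m.+4}).
Notation n := m.+4.
Notation T := {perm 'I_n}.
Notation i0 := (i0 m).
Notation i1 := (i1 m).
Hypothesis j2 : 2 < j.
Hypothesis jn : j < n.
Implicit Types (p q r : T) (a b : 'I_n).

(** The symbol at the last free position [l] names the copy, and the triangles of [turn l] join the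
    copies. *)
Let l : 'I_n := Ordinal jn.
Let V := cell j.+1 p0.
Let cp p : 'I_n := p l.
Let o := turn l.
Let A := symbols j.+1 p0.

Let l1 : 1 < l. Proof. exact: ltnW j2. Qed.

Let cp_o p : cp (o p) = p i1. Proof. exact: turn_k. Qed.
Let cp_oo p : cp (o (o p)) = p i0. Proof. by rewrite cp_o /o turn_1. Qed.

Let oV p : p \in V -> o p \in V.
Proof. by rewrite /V /o cell_turn // l1 /= ltnSn. Qed.

Let cpA p : p \in V -> cp p \in A.
Proof. by move=> pV; rewrite (mem_symbols _ pV) /= ltnSn. Qed.

Let copy_cell a q : q \in copy V cp a -> copy V cp a = cell j q.
Proof. by case/copyP=> qV <-; rewrite (cell_split (l := l) _ qV). Qed.

Let card_copyN a : a \in A -> 2 * #|copy V cp a| = j`!.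
Proof.
move=> aA.
have cj : 2 < j.+1 <= n by rewrite jn andbT (leq_trans j2).
have := @card_cell m j.+1 p0; rewrite jn ltnS ltnW ?(ltnW j2) // => /(_ isT).
rewrite -(card_cell_pos cj (ltnSn l) aA) factS mulnCA => /eqP.
by rewrite eqn_pmul2l // => /eqP.
Qed.

Let copy_mem a : a \in A -> exists q, q \in copy V cp a.
Proof.
by move=> aA; apply/card_gt0P; rewrite -(ltn_pmul2l (isT : 0 < 2)) muln0 (card_copyN aA) fact_gt0.
Qed.

(** The words counted have [b] at position 0 or 1, and each case contributes the fraction 1/[j] of
    the j!/2 words of the copy. *)
Let card_matchingN a b : a \in A -> b \in A -> a != b ->
  #|[set p in copy V cp a | (cp (o p) == b) || (cp (o (o p)) == b)]| = (j.-1)`!.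
Proof.
move=> aA bA ab; have [q qa] := copy_mem aA.
have /copyP[qV qla] := qa; rewrite (copy_cell qa).
have bq : b \in symbols j q.
  have qq : q \in cell j.+1 q by rewrite (cell_congr qV).
  have qq' : q \in cell j q by rewrite -(copy_cell qa).
  have : (q^-1)%g b < j.+1 by rewrite -(mem_symbols _ qV) permKV.
  rewrite ltnS leq_eqVlt => /orP[/eqP E|E].
    case/eqP: ab; rewrite -qla -(permKV q b); congr (q _); exact/val_inj/esym.
  by rewrite -(permKV q b) (mem_symbols _ qq').
have jj : 2 < j <= n by rewrite j2 ltnW.
have c0 := card_cell_pos jj (ltn_trans (isT : i0 < 2) j2) bq.
have c1 := card_cell_pos jj (ltn_trans (isT : i1 < 2) j2) bq.
have cj : 2 * #|cell j q| = j * (j.-1)`!.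
  by rewrite card_cell ?(ltnW jn) ?(ltnW j2) // -{1}(ltn_predK j2) factS (ltn_predK j2).
have -> : [set p in cell j q | (cp (o p) == b) || (cp (o (o p)) == b)] =
    [set p in cell j q | p i1 == b] :|: [set p in cell j q | p i0 == b].
  by apply/setP=> p; rewrite !(in_setU, in_set) cp_o cp_oo andb_orr.
rewrite cardsU (_ : _ :&: _ = set0) ?cards0 ?subn0; last first.
  apply/setP=> p; rewrite in_set0; apply/setIP=> -[/setIdP[_ /eqP E] /setIdP[_ /eqP]].
  by rewrite -E => /perm_inj.
nia.
Qed.

Let IHN : kbound m j -> forall a (S R : {set T}),
  separated (@adj m j) (copy V cp a :\: S) R -> #|R| <= 5 ->
  kap #|R|.-1 j <= #|copy V cp a :&: S|.
Proof.
move=> IH a S R sepR R5; have [E|[q qa]] := set_0Vmem (copy V cp a).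
  suff -> : R = set0 by rewrite cards0.
  apply/setP=> r; rewrite in_set0; apply/negP=> /(proj1 sepR).
  by rewrite E in_setD in_set0 andbF.
by rewrite (copy_cell qa) in sepR *; apply: IH.
Qed.

(** By [adj_low_symbols] each triangle of the generator at position 2 has at most one vertex in
    [Tr]. Hence [Tr] and its two rotations are disjoint within the copy. *)
Let card_tripleN (B : {set 'I_n}) a : #|B| <= 3 -> a \in B ->
  3 * #|[set p in copy V cp a | (cp (o p) \in B) && (cp (o (o p)) \in B)]|
    <= #|copy V cp a|.
Proof.
move=> B3 aB; set Tr := [set p in _ | _].
pose k : 'I_n := @Ordinal n 2 isT; have k1 : 1 < k by [].
have kl : l != k by rewrite -val_eqE /=; lia.
have TrP p : p \in Tr -> [/\ p \in V, cp p = a, p i0 \in B & p i1 \in B].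
  by rewrite in_set cp_o cp_oo => /andP[/copyP[pV pa] /andP[]].
have noTr p q : p \in Tr -> q \in Tr -> ~ tri k p q.
  move=> /TrP[pV pa pB0 pB1] /TrP[_ _ qB0 qB1] t.
  have pq : adj j p q by apply/adjP; exists k.
  have := adj_low_symbols (l := l) (leqnn j) pq B3 pB0 pB1.
  by rewrite qB0 qB1 -[p l]/(cp p) pa => /(_ aB).
have tc p : p \in copy V cp a -> turn k p \in copy V cp a.
  case/copyP=> pV pa; apply/copyP; rewrite /cp turn_fix //; split=> //.
  by rewrite /V cell_turn // k1 /=; lia.
have sub : Tr \subset copy V cp a by apply/subsetP=> p /setIdP[].
pose T1 := turn k @: Tr; pose T2 := turn k @: T1.
have inj := @turn_inj m k.
have -> : 3 * #|Tr| = #|Tr :|: T1 :|: T2|.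
  rewrite !cardsU (_ : Tr :&: T1 = set0) ?cards0 ?subn0; last first.
    apply/setP=> p; rewrite in_set0; apply/setIP=> -[pT /imsetP[q qT E]].
    by apply: (noTr q p) => //; left.
  rewrite (_ : _ :&: T2 = set0) ?cards0 ?subn0; last first.
    apply/setP=> p; rewrite in_set0.
    apply/setIP=> -[/setUP[pT|/imsetP[q qT Ep]] /imsetP[_ /imsetP[r rT ->] E]].
      by apply: (noTr r p) => //; right; rewrite E turn3.
    by apply: (noTr r q) => //; left; apply: inj; rewrite -Ep.
  by rewrite /T2 /T1 !card_imset // !mulSn mul0n addn0 addnA.
apply: subset_leq_card; rewrite !subUset sub /=; apply/andP; split.
  by apply/subsetP=> _ /imsetP[p /(subsetP sub) pa ->]; apply: tc.
apply/subsetP=> _ /imsetP[_ /imsetP[p /(subsetP sub) pa ->] ->]; exact/tc/tc.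
Qed.

Let sizes3 : j = 3 -> j`! %/ 2 = 3 /\ (j.-1)`! = 2. Proof. by move->. Qed.
Let sizes4 : j = 4 -> j`! %/ 2 = 12 /\ (j.-1)`! = 6. Proof. by move->. Qed.
Let sizes5 : 5 <= j -> 12 * j <= j`! %/ 2 /\ 4 * j - 10 < (j.-1)`!.
Proof.
case: j => [|[|[|[|[|k]]]]] // _.
have f6 : 6 <= (k.+3)`!.
  rewrite factS factS.
  exact: (leq_mul (isT : 3 <= k.+3) (leq_mul (isT : 2 <= k.+2) (fact_gt0 k.+1))).
rewrite leq_divRL // !(factS k.+4) !(factS k.+3) /=.
by move: (k.+3)`! f6 => f f6; split; nia.
Qed.

(** The step from triangles to $AG_4$ gives the bound for two components only; [kbound4] derives the
    others from it. *)
Lemma kbound_next (S R : {set T}) : kbound m j ->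
  separated (@adj m j.+1) (V :\: S) R ->
  #|R| <= (if j == 3 then 2 else 5) -> kap #|R|.-1 j.+1 <= #|V :&: S|.
Proof.
move=> IH sepR cR.
have cpV p : p \in V -> cp (o p) != cp p.
  by move=> _; rewrite cp_o (inj_eq perm_inj) i1_neq.
have eo p : p \in V -> adj j.+1 p (o p).
  by move=> _; apply/adjP; exists l; split=> //; left.
have eV p q : p \in V -> adj j p q -> q \in V /\ cp q = cp p.
  move=> pV pq; split; first by rewrite /V (cell_adj _ (adj_le (leqnSn j) pq)).
  case/adjP: pq => k [k1 kj t]; apply: tri_fix t => //.
  by apply: contraTneq kj => <-; rewrite /= ltnn.
have cA : #|A| = j.+1 by rewrite card_symbols.
have cc a : a \in A -> #|copy V cp a| = j`! %/ 2.
  by move/card_copyN <-; rewrite mulKn.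
have cn p : p \in V -> #|[set q | adj j p q]| = 2 * j - 4.
  by move=> _; apply: card_nb; rewrite (ltnW j2) ltnW.
have com p p' b : p \in V -> p' \in V -> p != p' -> ~~ adj j p p' -> cp p = cp p' ->
    (cp (o p) == b) || (cp (o (o p)) == b) -> (cp (o p') == b) || (cp (o (o p')) == b) ->
    #|[set q | adj j p q] :&: [set q | adj j p' q]| <= 1.
  move=> _ _ pp' npp' _; rewrite !cp_oo !cp_o => bp bp'.
  apply/card_le1P=> r; rewrite !inE => /andP[pr pr'] r'.
  apply/idP/eqP => [|->]; rewrite !inE ?pr // => /andP[pr2 pr2'].
  by apply: (common_nb_uniq (b := b) pp' npp'); rewrite // !inE ![b == _]eq_sym orbC.
have nt (B : {set 'I_n}) p q : #|B| <= 3 -> p \in V -> adj j p q -> cp p \in B ->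
    cp (o p) \in B -> cp (o (o p)) \in B -> ~~ ((cp (o q) \in B) && (cp (o (o q)) \in B)).
  move=> B3 _ pq; rewrite !cp_oo !cp_o andbC => pB pB1 pB0.
  exact: (adj_low_symbols (l := l) (leqnn j) pq).
have o3 := @turn3 m l l1.
have [j3|j3] := eqVneq j 3.
  apply: (step_bound3 (@adj_sym m j.+1) (@adj_sym m j) o3 oV cpA cpV (adj_le (leqnSn j)) eo
    cA cc card_matchingN (IHN IH) j2 sizes3 sizes4 sizes5 j3 sepR).
  by rewrite j3 in cR.
have j4 : 3 < j by rewrite ltn_neqAle eq_sym j3.
apply: (step_bound (@adj_sym m j.+1) (@adj_sym m j) (@adj_irr m j) o3 oV cpA cpV
  (adj_le (leqnSn j)) eo eV cA cc card_matchingN (IHN IH) cn com nt card_tripleN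
  j2 sizes3 sizes4 sizes5 j4 sepR).
by rewrite (negPf j3) in cR.
Qed.

End Induction.

(** * The lower bound, starting from $AG_4$ *)

Section LowerBound.
Variable m : nat.
Notation n := m.+4.
Notation T := {perm 'I_n}.
Implicit Types (p q r s : T).

(* In [AG_4] every vertex lies in two triangles, and a triangle meets at most
   one component; as each component has at least 4 deleted neighbours, [k]
   components require [4 * k / 2] deleted vertices. *)
Lemma kbound4 : kbound m 4.
Proof.
move=> p0 S R sepR R5; have [RW sep] := sepR.
set V := cell 4 p0; set W := V :\: S.
have [R1|R1] := leqP #|R| 1; first by case: #|R| R1 => [|[|]].
suff : 2 * #|R| <= #|V :&: S|.
  by apply: leq_trans; case: #|R| R5 => [|[|[|[|[|[|]]]]]].
have csym : connect_sym (induced_rel (@adj m 4) W).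
  exact/induced_connect_sym/adj_sym.
pose near r s := [exists p in W, connect (induced_rel (@adj m 4) W) r p && adj 4 p s].
pose N r := [set s in V :&: S | near r s].
have N4 r : r \in R -> 4 <= #|N r|.
  move=> rR; have [r' r'R r'r] : exists2 r', r' \in R & r' != r.
    have : 0 < #|R :\ r| by move: R1; rewrite (cardsD1 r) rR.
    by case/card_gt0P=> r' /setD1P[]; exists r'.
  have rW := RW r rR.
  (* Deleting [N r] alone still cuts the component of [r] off from [r'], so the bound for two
     components applies to [N r]. *)
  have sepN : separated (@adj m 4) (V :\: N r) [set r; r'].
    have notN x : x \in W -> x \in V :\: N r.
      by case/setDP=> xV xS; rewrite !in_setD xV andbT in_set in_setI negb_and (negPf xS) andbF.
    suff nc : ~~ connect (induced_rel (@adj m 4) (V :\: N r)) r r'.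
      split=> [x /set2P[]->|x y /set2P[]-> /set2P[]->] //.
      - exact: notN.
      - by apply: notN; apply: RW.
      - by rewrite (negPf nc).
      - by rewrite (induced_connect_sym (@adj_sym m 4)) (negPf nc).
    pose D := [set p in W | connect (induced_rel (@adj m 4) W) r p].
    have clD : closed (induced_rel (@adj m 4) (V :\: N r)) D.
      apply: intro_closed => [|x y /and3P[_ /setDP[yV yN] xy] /setIdP[xW rx]].
        exact/induced_connect_sym/adj_sym.
      have yS : y \notin S.
        apply: contra yN => yS; apply/setIdP; split; first by rewrite in_setI yV.
        by apply/exists_inP; exists x => //; rewrite rx.
      have yW : y \in W by rewrite in_setD yS.
      apply/setIdP; split=> //; apply: connect_trans rx _.
      exact: connect_induced_step.
    apply/negP=> /(closed_connect clD) E.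
    have : r' \in D by rewrite -E; apply/setIdP; split=> //; apply: connect0.
    case/setIdP=> _ /(sep _ _ rR r'R) {}E.
    by rewrite E eqxx in r'r.
  have := @kbound_next m 3 p0 isT isT _ _ (@kbound3 m) sepN.
  rewrite cards2 eq_sym r'r /= => /(_ isT) /leq_trans; apply.
  by apply/subset_leq_card/subsetIr.
have N2 s : s \in V :&: S -> #|[set r in R | near r s]| <= 2.
  move=> _; pose i2 : 'I_n := @Ordinal n 2 isT; pose i3 : 'I_n := @Ordinal n 3 isT.
  pose via (k : 'I_n) r := [exists p in W, connect (induced_rel (@adj m 4) W) r p &&
    ((s == turn k p) || (p == turn k s))].
  have via_inj (k : 'I_n) r r' : 1 < k < 4 -> r \in R -> r' \in R -> via k r -> via k r' -> r = r'.
    case/andP=> k1 k4 rR r'R /exists_inP[p pW /andP[rp ps]] /exists_inP[p' pW' /andP[rp' ps']].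
    have tp : tri k p s by case/orP: ps => /eqP; [left|right].
    have tp' : tri k s p' by apply: tri_sym; case/orP: ps' => /eqP; [left|right].
    apply: sep => //; apply: connect_trans rp _; rewrite csym.
    apply: connect_trans rp' _; rewrite csym.
    case: (tri_trans k1 tp tp') => [->|t]; first exact: connect0.
    by apply: connect_induced_step => //; apply/adjP; exists k.
  have viaN r : near r s -> via i2 r || via i3 r.
    case/exists_inP=> p pW /andP[rp /adjP[k [k1 k4 t]]].
    have tb : (s == turn k p) || (p == turn k s) by case: t => ->; rewrite eqxx ?orbT.
    have [k2|k2] := eqVneq k i2.
      by apply/orP; left; apply/exists_inP; exists p; rewrite // rp -k2.
    have k3 : k = i3.
      by apply: val_inj; rewrite /=; move: k2; rewrite -val_eqE /=; lia.
    by apply/orP; right; apply/exists_inP; exists p; rewrite // rp -k3.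
  (* At most one representative reaches [s] through each of its two triangles, so the truth value of
     [via i2] tells them apart. *)
  rewrite -card_bool -(@card_in_imset _ _ (via i2)) ?max_card //.
  move=> r r' /setIdP[rR /viaN vr] /setIdP[rR' /viaN vr'] E.
  case v2: (via i2 r); have v2' := etrans (esym E) v2.
    exact: (via_inj i2).
  by rewrite v2 v2' /= in vr vr'; apply: (via_inj i3).
have S4 : 4 * #|R| <= \sum_(r in R) #|N r|.
  by rewrite mulnC -sum_nat_const; apply: leq_sum => r /N4.
have S2 : \sum_(r in R) #|N r| <= 2 * #|V :&: S|.
  rewrite (eq_bigr (fun r => \sum_(s in V :&: S | near r s) 1)); last first.
    by move=> r _; rewrite -sum1_card; apply: eq_bigl => s; rewrite in_set.
  rewrite (exchange_big_dep (mem (V :&: S))) //=; last by move=> r s _ /andP[].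
  rewrite mulnC -sum_nat_const; apply: leq_sum => s sS.
  apply: leq_trans (N2 s sS); rewrite -sum1_card.
  by apply/eq_leq/eq_bigl => r; rewrite in_set sS.
by rewrite -(leq_pmul2l (isT : 0 < 2)) mulnA (leq_trans S4 S2).
Qed.

Lemma kbound_ge4 j : 3 < j <= n -> kbound m j.
Proof.
elim: j => [//|j IH] /andP[j3 jn].
have [->|j4] := eqVneq j 3; first exact: kbound4.
have {}j3 : 3 < j by rewrite ltn_neqAle eq_sym j4.
have IHj : kbound m j by apply: IH; rewrite j3 ltnW.
by move=> p0 S R sepR R5; apply: kbound_next sepR _; rewrite ?(negPf j4) // ltnW.
Qed.

Lemma ncomp_cut_ge (S : {set T}) t : t <= 4 -> t.+1 <= ncomp (@adj m n) (AG_vertices n :\: S) ->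
  kap t n <= #|AG_vertices n :&: S|.
Proof.
move=> t4 /(ncomp_separated (@adj_sym m n))[R]; rewrite -(cell_full 1%g) => sepR cR.
by have := @kbound_ge4 n _ 1%g S R sepR; rewrite cR leqnn; apply.
Qed.

End LowerBound.

(** * The upper bound: isolating words of a Klein four-group orbit *)

Section UpperBound.
Variable m : nat.
Notation n := m.+4.
Notation T := {perm 'I_n}.
Notation i0 := (i0 m).
Notation i1 := (i1 m).
Notation V := (AG_vertices n).
Implicit Types (p q r v : T).

(** Deleting all neighbours of an independent set isolates its members. The size condition leaves a
    vertex [z] for one further component. *)
Lemma isolated_cut (R : {set T}) (C := \bigcup_(r in R) nb n r) :
  R \subset V -> {in R &, forall p q, ~~ adj n p q} -> #|C| + #|R| < #|V| ->
  C \subset V /\ #|R|.+1 <= ncomp (@adj m n) (V :\: C).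
Proof.
move=> /subsetP RV indep small.
have CV : C \subset V.
  apply/bigcupsP=> r /RV; rewrite -(cell_full 1%g) => rV.
  by apply/subsetP=> q; rewrite in_set => /cell_adj ->.
split=> //.
have RC r : r \in R -> r \notin C.
  move=> rR; apply/bigcupP=> -[q qR]; rewrite in_set.
  by apply/negP; apply: indep.
have /card_gt0P[z /setDP[zV]] : 0 < #|V :\: (C :|: R)|.
  rewrite cardsDS ?subUset ?CV ?subn_gt0; last exact/subsetP.
  exact: leq_ltn_trans (leq_card_setU C R) small.
rewrite in_setU negb_or => /andP[zC zR].
have -> : #|R|.+1 = #|z |: R| by rewrite cardsU1 zR.
have iso r y : r \in R -> connect (induced_rel (@adj m n) (V :\: C)) r y -> r = y.
  move=> rR /connectP[[|a s] /=]; first by move=> _ ->.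
  case/andP=> /and3P[_ /setDP[_ aC] ra] _ _.
  by case/bigcupP: aC; exists r; rewrite // in_set.
apply: card_separated_ncomp; split=> [x /setU1P[->|xR]|x y].
- by rewrite in_setD zC.
- by rewrite in_setD RC // RV.
move=> /setU1P[->|xR] /setU1P[->|yR] //; last exact: iso.
  by rewrite (induced_connect_sym (@adj_sym m n)) => /(iso _ _ yR).
exact: iso.
Qed.

Section TwoGenerators.
Variables k l : 'I_n.
Hypotheses (k1 : 1 < k) (l1 : 1 < l) (kl : k != l).

Let lk : l != k. Proof. by rewrite eq_sym. Qed.

Let genE := (gen_0 k, gen_0 l, gen_1 k1, gen_1 l1, gen_k k1, gen_k l1,
  gen_fix l1 lk, gen_fix k1 kl).

(** The two turns together exchange position 0 with [k] and 1 with [l], a double transposition. *)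
Lemma turn_involution v : turn k (turn l (turn k (turn l v))) = v.
Proof.
apply/permP=> x; rewrite !turnE; congr (v _).
have [->|->|x1] := ord_cases x; rewrite ?genE //.
have [->|xk] := eqVneq x k; first by rewrite !genE.
have [->|xl] := eqVneq x l; first by rewrite !genE.
by rewrite !gen_fix.
Qed.

(** Two double transpositions of positions 0, 1, [k], [l] are composed in either order, and the
    Klein four-group is commutative. *)
Lemma turn_commute v :
  turn k (turn l (turn l (turn k v))) = turn l (turn k (turn k (turn l v))).
Proof.
apply/permP=> x; rewrite !turnE; congr (v _).
have [->|->|x1] := ord_cases x; rewrite ?genE //.
have [->|xk] := eqVneq x k; first by rewrite !genE.
have [->|xl] := eqVneq x l; first by rewrite !genE.
by rewrite !gen_fix.
Qed.

Lemma adj_turn p : adj n p (turn k p).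
Proof. by apply/adjP; exists k; split; rewrite ?ltn_ord //; left. Qed.

(** One generator cannot change both positions. The four Klein words differ pairwise at both 2 and
    3, so no two of them are adjacent. *)
Lemma adj_agree p q : adj n p q -> p k = q k \/ p l = q l.
Proof.
case/adjP=> h [h1 _ t]; have [hk|hk] := eqVneq h k.
  by right; rewrite (tri_fix l1 _ t) // hk.
by left; rewrite (tri_fix k1 _ t) // eq_sym.
Qed.

End TwoGenerators.

Let i2 : 'I_n := @Ordinal n 2 isT.
Let i3 : 'I_n := @Ordinal n 3 isT.
Let i23 : i2 != i3. Proof. by []. Qed.
Let i32 : i3 != i2. Proof. by []. Qed.
(* The words xyuv, uvxy, vuyx, yxvu on positions 0, 1, 2, 3. *)
Let v0 : T := 1%g.
Let v1 : T := turn i2 (turn i3 v0).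
Let v2 : T := turn i3 (turn i2 v0).
Let v3 : T := turn i2 (turn i3 v2).

Let v0_1 : v0 = turn i2 (turn i3 v1). Proof. by rewrite turn_involution. Qed.
Let v0_2 : v0 = turn i3 (turn i2 v2). Proof. by rewrite turn_involution. Qed.
Let v2_3 : v2 = turn i2 (turn i3 v3). Proof. by rewrite turn_involution. Qed.
Let v3_1 : v3 = turn i3 (turn i2 v1). Proof. exact: turn_commute. Qed.
Let v1_3 : v1 = turn i3 (turn i2 v3).
Proof. by rewrite v3_1 turn_involution. Qed.

Let gen23 := (gen_0 i2, gen_0 i3, @gen_1 m i2 isT, @gen_1 m i3 isT,
  @gen_k m i2 isT, @gen_k m i3 isT, @gen_fix m i2 i3 isT i32, @gen_fix m i3 i2 isT i23).

Let words :
  [/\ [/\ v0 i0 = i0, v0 i2 = i2 & v0 i3 = i3], [/\ v1 i0 = i2, v1 i2 = i0 & v1 i3 = i1],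
      [/\ v2 i0 = i3, v2 i2 = i1 & v2 i3 = i0] & [/\ v3 i0 = i1, v3 i2 = i3 & v3 i3 = i2]].
Proof. by rewrite /v3 /v2 /v1 /v0; split; split; rewrite ?turnE !perm1 ?gen23. Qed.

Let mem_common k l p q : q = turn l (turn k p) -> 1 < k -> 1 < l ->
  turn k p \in nb n p /\ turn k p \in nb n q.
Proof.
by move=> -> k1 l1; rewrite !in_set adj_turn // adj_sym adj_turn.
Qed.

Lemma card_setU_nb (C : {set T}) v (s : seq T) : uniq s -> {subset s <= C :&: nb n v} ->
  #|C :|: nb n v| + size s <= #|C| + (2 * n - 4).
Proof.
move=> us sub; rewrite cardsU card_nb ?leqnn //.
have : size s <= #|C :&: nb n v|.
  by rewrite cardE; apply: uniq_leq_size => // x /sub; rewrite mem_enum.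
have : #|C :&: nb n v| <= 2 * n - 4.
  by rewrite -(@card_nb m n v) ?leqnn //; apply/subset_leq_card/subsetIr.
by move: #|_ :&: _| => c; clear; lia.
Qed.

Let uniq_v : uniq [:: v0; v1; v2; v3].
Proof.
apply: (@map_uniq _ _ (fun w : T => w i2)) => /=.
by case: words => -[_ -> _] [_ -> _] [_ -> _] [_ -> _].
Qed.

Let klein_indep : {in [:: v0; v1; v2; v3] &, forall p q, ~~ adj n p q}.
Proof.
move=> p q pv qv; apply/negP=> pq.
have : p != q by apply: contraTneq pq => ->; rewrite adj_irr.
case: words => -[_ a0 b0] [_ a1 b1] [_ a2 b2] [_ a3 b3].
have := @adj_agree i2 i3 isT isT i23 p q pq; move: pv qv {pq}; rewrite !inE.
by case/or4P=> /eqP -> /or4P[] /eqP -> //; rewrite ?eqxx // ?a0 ?a1 ?a2 ?a3 ?b0 ?b1 ?b2 ?b3;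
   case=> /eqP.
Qed.

Let cut2 := nb n v0 :|: nb n v1.
Let cut3 := cut2 :|: nb n v2.
Let cut4 := cut3 :|: nb n v3.

(** The double transposition linking [v0] and [v1] is a path of length 2 in either direction, which
    gives two common neighbours. *)
Let card_cut2 : #|cut2| <= 4 * n - 10.
Proof.
have H := @card_setU_nb (nb n v0) v1 [:: turn i3 v0; turn i3 v1].
have : #|cut2| + 2 <= 2 * n - 4 + (2 * n - 4).
  rewrite -{1}(@card_nb m n v0) ?leqnn //; apply: H.
    rewrite /= inE (inj_eq (@turn_inj m i3)).
    by have := uniq_v; rewrite /= !inE !negb_or => /andP[/and3P[-> _ _] _].
  have [a a'] := mem_common (erefl : v1 = turn i2 (turn i3 v0)) isT isT.
  have [b b'] := mem_common v0_1 isT isT.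
  by move=> x; rewrite !in_cons orbF => /orP[] /eqP ->; rewrite in_setI ?a ?a' ?b ?b'.
by move: #|cut2|; clear; lia.
Qed.

Let card_cut3 : #|cut3| <= 6 * n - 16.
Proof.
have H := @card_setU_nb cut2 v2 [:: turn i2 v0; turn i2 v2].
have : #|cut3| + 2 <= #|cut2| + (2 * n - 4).
  apply: H.
    rewrite /= inE (inj_eq (@turn_inj m i2)).
    by have := uniq_v; rewrite /= !inE !negb_or => /andP[/and3P[_ -> _] _].
  have [a a'] := mem_common (erefl : v2 = turn i3 (turn i2 v0)) isT isT.
  have [b b'] := mem_common v0_2 isT isT.
  by move=> x; rewrite !in_cons orbF => /orP[] /eqP ->; rewrite !in_setI !in_setU ?a ?a' ?b ?b'.
by move: card_cut2; move: #|cut2| #|cut3|; clear; lia.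
Qed.

(** The last word shares two neighbours with [v1] and two more with [v2], so it saves four vertices
    instead of two. *)
Let card_cut4 : #|cut4| <= 8 * n - 24.
Proof.
have H := @card_setU_nb cut3 v3 [:: turn i2 v1; turn i2 v3; turn i3 v2; turn i3 v3].
have : #|cut4| + 4 <= #|cut3| + (2 * n - 4).
  apply: H.
    apply: (@map_uniq _ _ (fun w : T => (w i0, w i1))) => /=.
    rewrite !turn_0 !turn_1 //.
    by case: words => _ [-> -> _] [-> _ ->] [-> -> ->].
  have [a a'] := mem_common v3_1 isT isT.
  have [b b'] := mem_common v1_3 isT isT.
  have [c c'] := mem_common (erefl : v3 = turn i2 (turn i3 v2)) isT isT.
  have [d d'] := mem_common v2_3 isT isT.
  move=> x; rewrite !in_cons orbF => /or4P[] /eqP ->;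
  by rewrite !in_setI !in_setU ?a ?a' ?b ?b' ?c ?c' ?d ?d' ?orbT.
by move: card_cut3; move: #|cut3| #|cut4|; clear; lia.
Qed.

Lemma small_cut t : 1 < t <= 4 -> kap t n + t < #|V| ->
  exists C : {set T}, [/\ C \subset V, #|C| <= kap t n & t.+1 <= ncomp (@adj m n) (V :\: C)].
Proof.
move=> t24 small; pose s := take t [:: v0; v1; v2; v3].
have st : size s = t by rewrite size_take /=; case: t t24 {small s} => [|[|[|[|[|]]]]].
have sR : #|[set x in s]| = t.
  by rewrite cardsE (card_uniqP _) ?take_uniq.
have vV v : v \in [:: v0; v1; v2; v3] -> v \in V.
  rewrite in_set !in_cons orbF => /or4P[] /eqP ->;
  by rewrite /v3 /v2 /v1 /v0 ?odd_turn ?odd_perm1.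
pose C := \bigcup_(r in [set x in s]) nb n r.
have cC : #|C| <= kap t n.
  have sub (D : {set T}) : {in s, forall r, nb n r \subset D} -> #|C| <= #|D|.
    move=> sD; apply/subset_leq_card/bigcupsP => r; rewrite in_set; exact: sD.
  move: sub t24; rewrite /s; move: #|C| => c; case: (t) => [|[|[|[|[|]]]]] //= sub _.
  - apply: leq_trans card_cut2; apply: sub => r.
    by rewrite !in_cons orbF => /orP[] /eqP ->; rewrite /cut2 ?subsetUl ?subsetUr.
  - apply: leq_trans card_cut3; apply: sub => r.
    rewrite !in_cons orbF => /or3P[] /eqP ->; rewrite /cut3 /cut2 ?subsetUr //.
      by rewrite -setUA subsetUl.
    by rewrite (setUC (nb n v0)) -setUA subsetUl.
  apply: leq_trans card_cut4; apply: sub => r.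
  rewrite !in_cons orbF => /or4P[] /eqP ->; rewrite /cut4 /cut3 /cut2 ?subsetUr //.
  - by rewrite -!setUA subsetUl.
  - by rewrite (setUC (nb n v0)) -!setUA subsetUl.
  by rewrite (setUC _ (nb n v2)) -!setUA subsetUl.
have [|||CV nc] := @isolated_cut [set x in s].
- by apply/subsetP=> x; rewrite in_set => /mem_take /vV.
- by move=> p q; rewrite !in_set => /mem_take pv /mem_take qv; apply: klein_indep.
- by rewrite sR; apply: leq_ltn_trans small; rewrite leq_add2r.
by exists C; rewrite sR in nc.
Qed.

End UpperBound.

(** * The values of the component connectivities *)

(** The condition [K <= #|V|] keeps the default value of the minimum from undercutting [K]. *)
Lemma kappa_l_eq (T : finType) (l : nat) (V : {set T}) (e : rel T) K :
  K <= #|V| -> (exists2 S, lcomp_cut l V e S & #|S| <= K) ->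
  (forall S, lcomp_cut l V e S -> K <= #|S|) -> kappa_l l V e = K.
Proof.
move=> KV [S cutS SK] lower; apply/eqP; rewrite eqn_leq; apply/andP; split.
  apply: leq_trans SK; rewrite /kappa_l.
  have : S \in index_enum {set T} by apply: mem_index_enum.
  elim: (index_enum _) => [//|S' r IHr]; rewrite in_cons big_cons => /predU1P[<-|/IHr le].
    by rewrite cutS geq_minl.
  by case: ifP => // _; rewrite geq_min le orbT.
by rewrite /kappa_l; elim/big_ind: _ => // x y; rewrite leq_min => -> ->.
Qed.

Lemma eq_ncomp (T : finType) (e e' : rel T) (W : {set T}) : e =2 e' -> ncomp e W = ncomp e' W.
Proof.
move=> ee; rewrite /ncomp; congr #|pred_of_set _|; apply: eq_imset => x.
apply/setP=> y; rewrite !inE; congr (_ && _); apply: eq_connect => a b.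
by rewrite /induced_rel ee.
Qed.

Lemma kappa_AG n t : 3 < n -> 1 < t <= 4 -> kap t n + t < #|AG_vertices n| ->
  kappa_l t.+1 (AG_vertices n) (@AG_adj n) = kap t n.
Proof.
case: n => [|[|[|[|m]]]] // _ t24 small.
have AG W : ncomp (@AG_adj m.+4) W = ncomp (@adj m m.+4) W by apply/eq_ncomp/AG_adjE.
apply: kappa_l_eq.
- by apply: ltnW; apply: leq_ltn_trans small; rewrite leq_addr.
- have [C [CV cC nc]] := small_cut t24 small; exists C => //.
  by rewrite /lcomp_cut CV AG nc.
move=> S /andP[SV]; rewrite AG => /orP[nc|few].
  have t4 : t <= 4 by case/andP: t24.
  by have := ncomp_cut_ge t4 nc; rewrite (setIidPr SV).
(* Leaving at most [t] vertices requires at least [#|V| - t] deletions, more than [kap t n] by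
   [small]. *)
rewrite cardsDS // in few; move: small few; move: (kap _ _) #|_| #|S|; clear; lia.
Qed.

Lemma card_AG n : 3 < n -> 2 * #|AG_vertices n| = n`!.
Proof.
case: n => [|[|[|[|m]]]] // _; rewrite -(cell_full 1%g); by apply: card_cell; rewrite leqnn.
Qed.

Theorem theorem1 :
  (forall n : nat, 4 <= n ->
     kappa_l 3 (AG_vertices n) (@AG_adj n) = 4 * n - 10 /\
     kappa_l 4 (AG_vertices n) (@AG_adj n) = 6 * n - 16) /\
  (forall n : nat, 5 <= n ->
     kappa_l 5 (AG_vertices n) (@AG_adj n) = 8 * n - 24).
Proof.
have big n : 4 < n -> 12 * n <= #|AG_vertices n|.
  move=> n5; rewrite -(leq_pmul2l (isT : 0 < 2)) card_AG ?(ltnW n5) // mulnA.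
  case: n n5 => [|[|[|[|[|k]]]]] // _; rewrite factS mulnC leq_pmul2l // !factS.
  exact: (leq_mul (isT : 4 <= k.+4) (leq_mul (isT : 3 <= k.+3)
    (leq_mul (isT : 2 <= k.+2) (fact_gt0 k.+1)))).
have size4 n : n = 4 -> #|AG_vertices n| = 12.
  by move=> ->; apply/eqP; rewrite -(eqn_pmul2l (isT : 0 < 2)) card_AG.
split=> [n n4|n n5].
  have lt t : t < 4 -> kap t n + t < #|AG_vertices n|.
    move=> t4; have [n5|n5] := ltnP 4 n.
      apply: leq_trans (big n n5); case: t t4 => [|[|[|[|]]]] //= _; lia.
    have En : n = 4 by lia.
    by rewrite size4 // En; case: t t4 => [|[|[|[|]]]].
  by split; [apply: (@kappa_AG n 2 n4 isT (lt 2 isT)) | apply: (@kappa_AG n 3 n4 isT (lt 3 isT))].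
(* For [n = 4] the strict inequality would fail: 8 + 4 equals the number 12 of vertices. *)
by apply: (@kappa_AG n 4 (ltnW n5) isT); apply: leq_trans (big n n5); rewrite /=; lia.
Qed.
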